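(* Let $\operatorname{char}\mathbb{K}=p>0$, let $n\ge 2$ with $p\mid n$, and suppose $\mathcal{E}_{gh}\ne 0$ in $\overline{\mathcal{T}}_n$. Then $\overline{\mathcal{T}}_n(p)$ has GK-dimension $p-2$, with a PBW basis $$\{h^{n_2}\mathcal{E}_{\omega_{p-2}}^{n_{\omega_{p-2}}}\mathcal{E}_{\omega_{p-3}}^{n_{\omega_{p-3}}}\cdots\mathcal{E}_{\omega_1}^{n_{\omega_1}}g^{n_1}\mid 0\le n_2\le p-1,\ 0\le n_1\le n-1,\ n_{\omega_k}\in\mathbb{N},\ 1\le k\le p-2\}$$ satisfying the relations $$g^n=1,\quad h^p=0,\quad \mathcal{E}_{\omega_s}h=h\mathcal{E}_{\omega_s}+\mathcal{E}_{\omega_{s+1}},\quad \mathcal{E}_{\omega_{p-2}}h=h\mathcal{E}_{\omega_{p-2}},\quad \mathcal{E}_{\omega_s}\mathcal{E}_{\omega_t}=\mathcal{E}_{\omega_t}\mathcal{E}_{\omega_s},$$ where $0\le s<t\le p-2$.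
   Context: $\mathbb{K}$ is a field, $\mathbb{N}=\{0,1,2,\ldots\}$, and $[a,b]=ab-ba$. On words in the letters $g,h$ use the lexicographic order with $g\prec h$ (a proper prefix of a word is smaller than the word). A Lyndon word is a nonempty word $\alpha$ which is a single letter or satisfies $\alpha\prec\gamma\beta$ for every factorization $\alpha=\beta\gamma$ into nonempty words. $\alpha(g)$ is the number of occurrences of $g$ in $\alpha$. The standard factorization of a Lyndon word $\alpha$ of length at least $2$ is $\alpha=\beta\gamma$ with $\beta,\gamma$ Lyndon and $\gamma$ of maximal length. Define $E_g=g$, $E_h=h$ and $E_\alpha=[E_\beta,E_\gamma]$ for the standard factorization $\alpha=\beta\gamma$. $\mathcal{T}=\mathbb{K}\langle g,h\rangle$ is the free algebra, and $\overline{\mathcal{T}}=\mathcal{T}/\mathcal{I}$ where $\mathcal{I}$ is the ideal generated by all $E_\alpha$ with $\alpha$ Lyndon and $\alpha(g)\ge 2$. $\overline{\mathcal{T}}_n=\overline{\mathcal{T}}/(g^n-1)$. For $k\ge 0$, $\omega_k=gh^k$, so $E_{\omega_0}=g$, $E_{\omega_1}=E_{gh}=[g,h]$, $E_{\omega_k}=[E_{\omega_{k-1}},h]$; in any quotient of $\mathcal{T}$, $g,h,\mathcal{E}_{\omega_k}$ denote the images of $g,h,E_{\omega_k}$ (so $\mathcal{E}_{\omega_0}=g$, $\mathcal{E}_{gh}=\mathcal{E}_{\omega_1}$). $\overline{\mathcal{T}}_n'(p)=\overline{\mathcal{T}}_n/(\mathcal{E}_{\omega_{p-1}})$ and $\overline{\mathcal{T}}_n(p)=\overline{\mathcal{T}}_n'(p)/(h^p)$.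 A PBW basis means that the displayed ordered monomials form a $\mathbb{K}$-vector space basis. GK-dimension is Gelfand–Kirillov dimension. *)

(* Defs.v *)
From HB Require Import structures.
From mathcomp Require Import all_boot all_order all_algebra.
From mathcomp Require Import all_classical all_reals all_analysis.
From mathcomp.multinomials Require Import (canonicals) monalg.

Set Implicit Arguments.
Unset Strict Implicit.
Unset Printing Implicit Defensive.

Import Order.TTheory GRing.Theory Num.Theory.
Local Open Scope classical_set_scope.
Local Open Scope ring_scope.
Local Open Scope quotient_scope.

(* The algType of MathComp excludes the zero ring, but a quotient by an
   arbitrary ideal may be zero, hence the following structure of associative
   unital algebras where 1 = 0 is allowed.  The scaling is a field of the mixin
   because no structure may join PzRing and Lmodule below Lalgebra. *)
HB.mixin Record isPzAlgebra (K : pzRingType) A of GRing.PzRing A := {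
  pz_scale : K -> A -> A;
  pz_scaleA : forall a b v, pz_scale a (pz_scale b v) = pz_scale (a * b) v;
  pz_scale1 : left_id 1 pz_scale;
  pz_scaleDr : right_distributive pz_scale +%R;
  pz_scaleDl : forall v, {morph pz_scale^~ v : a b / a + b};
  pz_scaleAl : forall a u v, pz_scale a (u * v) = pz_scale a u * v;
  pz_scaleAr : forall a u v, pz_scale a (u * v) = u * pz_scale a v
}.

#[short(type="pzAlgType")]
HB.structure Definition PzAlgebra (K : pzRingType) :=
  {A of GRing.PzRing A & isPzAlgebra K A}.

HB.instance Definition _ (K : pzRingType) (A : pzAlgType K) :=
  GRing.Zmodule_isLmodule.Build K (PzAlgebra.sort A)
    (@pz_scaleA K A) (@pz_scale1 K A) (@pz_scaleDr K A) (@pz_scaleDl K A).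

Section GeneratedIdeal.
Variable A : pzRingType.

Definition two_sided_ideal (I : set A) : Prop :=
  [/\ I 0, forall x y, I x -> I y -> I (x + y),
      forall a x, I x -> I (a * x) & forall a x, I x -> I (x * a)].

Definition gen_ideal (S : set A) : set A := smallest two_sided_ideal S.

Lemma gen_idealP (S : set A) : two_sided_ideal (gen_ideal S).
Proof.
split.
- by move=> I [[]].
- move=> x y Sx Sy I IS; case: (IS) => -[_ ID _ _] _.
  by apply: ID; [exact: Sx | exact: Sy].
- by move=> a x Sx I IS; case: (IS) => -[_ _ IM _] _; apply: IM; exact: Sx.
- by move=> a x Sx I IS; case: (IS) => -[_ _ _ IM] _; apply: IM; exact: Sx.
Qed.

Definition gen_idealb (S : set A) (x : A) : bool := `[< gen_ideal S x >].

Lemma gen_idealb_zmod_closed (S : set A) : zmod_closed (gen_idealb S).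
Proof.
have [I0 ID IMl _] := gen_idealP S; split; first exact/asboolP.
move=> x y /asboolP Sx /asboolP Sy; apply/asboolP.
by apply: ID => //; rewrite -mulN1r; apply: IMl.
Qed.

HB.instance Definition _ (S : set A) :=
  GRing.isZmodClosed.Build A (gen_idealb S) (gen_idealb_zmod_closed S).
End GeneratedIdeal.

(* A two-sided ideal of a unital algebra is automatically stable under
   scalars. *)
Section QuotientAlgebra.
Variables (K : pzRingType) (A : pzAlgType K) (S : set A).

Definition quot_carrier :=
  Quotient.quot (GRing.ZmodClosed.clone A (gen_idealb S) _).
HB.instance Definition _ := GRing.Zmodule.on quot_carrier.

Definition quot_map (x : A) : quot_carrier := \pi_quot_carrier x.

Let rep (x : quot_carrier) : A := repr x.

Let repK x : quot_map (rep x) = x.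
Proof. exact: reprK. Qed.

Lemma quot_mapP x y : quot_map x = quot_map y <-> gen_ideal S (x - y).
Proof.
rewrite /quot_map; split.
  by move/eqP; rewrite -Quotient.idealrBE => /asboolP.
by move=> /asboolP ?; apply/eqP; rewrite -Quotient.idealrBE.
Qed.

Let quot_mapD x y : quot_map (x + y) = quot_map x + quot_map y.
Proof. exact: Quotient.pi_add. Qed.

Let quot_mapB x y : quot_map (x - y) = quot_map x - quot_map y.
Proof. by rewrite quot_mapD; congr (_ + _); exact: Quotient.pi_opp. Qed.

Let rep_map x : gen_ideal S (rep (quot_map x) - x).
Proof. by apply/quot_mapP; rewrite repK. Qed.

Let qone : quot_carrier := quot_map 1.
Let qmul (x y : quot_carrier) : quot_carrier := quot_map (rep x * rep y).
Let qscale (a : K) (x : quot_carrier) : quot_carrier := quot_map (a *: rep x).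

Let qmapM x y : qmul (quot_map x) (quot_map y) = quot_map (x * y).
Proof.
apply/quot_mapP; have [_ ID IMl IMr] := gen_idealP S.
rewrite -(subrKA (x * rep (quot_map y))) -mulrBl -mulrBr.
by apply: ID; [apply: IMr | apply: IMl].
Qed.

Let qmapZ a x : qscale a (quot_map x) = quot_map (a *: x).
Proof.
apply/quot_mapP; have [_ _ IMl _] := gen_idealP S.
by rewrite -scalerBr -[X in _ *: X]mul1r [X in gen_ideal S X]pz_scaleAl; apply: IMl.
Qed.

Let qmulA : associative qmul.
Proof.
by move=> x y z; rewrite -[x]repK -[y]repK -[z]repK !qmapM mulrA.
Qed.
Let qmul1 : left_id qone qmul.
Proof. by move=> x; rewrite -[x]repK qmapM mul1r. Qed.
Let qmulq1 : right_id qone qmul.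
Proof. by move=> x; rewrite -[x]repK qmapM mulr1. Qed.
Let qmulDl : left_distributive qmul +%R.
Proof.
move=> x y z; rewrite -[x]repK -[y]repK -[z]repK.
by rewrite !qmapM -!quot_mapD !qmapM mulrDl.
Qed.
Let qmulDr : right_distributive qmul +%R.
Proof.
move=> x y z; rewrite -[x]repK -[y]repK -[z]repK.
by rewrite !qmapM -!quot_mapD !qmapM mulrDr.
Qed.

HB.instance Definition _ := GRing.Zmodule_isPzRing.Build quot_carrier
  qmulA qmul1 qmulq1 qmulDl qmulDr.

Let qscaleA a b x : qscale a (qscale b x) = qscale (a * b) x.
Proof. by rewrite -[x]repK !qmapZ scalerA. Qed.
Let qscale1 : left_id 1 qscale.
Proof. by move=> x; rewrite -[x]repK qmapZ scale1r. Qed.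
Let qscaleDr : right_distributive qscale +%R.
Proof.
by move=> a x y; rewrite -[x]repK -[y]repK !qmapZ -!quot_mapD qmapZ scalerDr.
Qed.
Let qscaleDl x : {morph qscale^~ x : a b / a + b}.
Proof. by move=> a b /=; rewrite -[x]repK !qmapZ -quot_mapD scalerDl. Qed.

Let qscaleAl a x y : qscale a (x * y) = qscale a x * y.
Proof.
rewrite -[x]repK -[y]repK qmapZ.
by rewrite /GRing.mul /= !qmapM qmapZ -pz_scaleAl.
Qed.
Let qscaleAr a x y : qscale a (x * y) = x * qscale a y.
Proof.
rewrite -[x]repK -[y]repK qmapZ.
by rewrite /GRing.mul /= !qmapM qmapZ -pz_scaleAr.
Qed.

HB.instance Definition _ := isPzAlgebra.Build K quot_carrier
  qscaleA qscale1 qscaleDr qscaleDl qscaleAl qscaleAr.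

Definition quot_alg : pzAlgType K := quot_carrier.

Definition quot_proj (x : A) : quot_alg := quot_map x.

Lemma quot_projP x y : quot_proj x = quot_proj y <-> gen_ideal S (x - y).
Proof. exact: quot_mapP. Qed.

Lemma quot_proj_surj (y : quot_alg) : exists x, quot_proj x = y.
Proof. by exists (rep y); exact: repK. Qed.

Lemma quot_proj_zmod_morphism : zmod_morphism quot_proj.
Proof. exact: quot_mapB. Qed.

HB.instance Definition _ :=
  GRing.isZmodMorphism.Build A quot_alg quot_proj quot_proj_zmod_morphism.

Lemma quot_proj_monoid_morphism : monoid_morphism quot_proj.
Proof. by split=> // x y; rewrite [RHS]qmapM. Qed.

HB.instance Definition _ :=
  GRing.isMonoidMorphism.Build A quot_alg quot_proj quot_proj_monoid_morphism.

Lemma quot_proj_scalable : scalable quot_proj.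
Proof. by move=> a x; rewrite [RHS]qmapZ. Qed.

HB.instance Definition _ :=
  GRing.isScalable.Build K A quot_alg *:%R quot_proj quot_proj_scalable.
End QuotientAlgebra.

Section LinearAlgebra.
Variables (K : pzRingType) (V : lmodType K).

Definition lin_indep (I : choiceType) (b : I -> V) : Prop :=
  forall (s : seq I) (c : I -> K), uniq s ->
    \sum_(i <- s) c i *: b i = 0 -> forall i, i \in s -> c i = 0.

Definition lin_span (B : set V) : set V :=
  [set v | exists (m : nat) (b : 'I_m -> V) (c : 'I_m -> K),
     (forall i, B (b i)) /\ v = \sum_(i < m) c i *: b i].

Definition is_basis (I : choiceType) (b : I -> V) : Prop :=
  lin_indep b /\ lin_span (range b) = setT.

Definition lin_dim (R : realType) (U : set V) : \bar R :=
  ereal_sup [set m%:R%:E | m in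
    [set m : nat | exists b : 'I_m -> V, (forall i, U (b i)) /\ lin_indep b]].

Definition fin_dim_subspace (U : set V) : Prop :=
  exists (m : nat) (b : 'I_m -> V), U = lin_span (range b).
End LinearAlgebra.

Section GelfandKirillov.
Variables (K : pzRingType) (A : pzAlgType K).

(* V^0 + V^1 + ... + V^m, with V^0 = K.1 given by the empty product *)
Definition sum_powers (V : set A) (m : nat) : set A :=
  lin_span [set \prod_(x <- w) x |
    w in [set w : seq A | (size w <= m)%N /\ forall x, x \in w -> V x]].

(* [1 / ln m] is the junk value 0 for m = 0, 1, which the limsup ignores;
   [lne 0 = -oo], so that the zero algebra has dimension -oo. *)
Definition GKdim (R : realType) : \bar R :=
  ereal_sup [set limn_esup (fun m : nat =>
      (lne (lin_dim R (sum_powers V m)) * ((ln m%:R)^-1)%:E)%E) |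
    V in [set V : set A | fin_dim_subspace V]].
End GelfandKirillov.

(* Words in g and h: g is coded by false and h by true, so that g < h. *)
Notation word := (seqlexi bool).
Notation gl := false (only parsing).
Notation hl := true (only parsing).

Definition lyndon (w : word) : bool :=
  (w != [::]) &&
  all (fun i => (w < (drop i w ++ take i w : word))%O) (iota 1 (size w).-1).

Lemma lyndonP (w : word) :
  reflect (w <> [::] /\ (size w = 1%N \/ forall b c : word,
             b <> [::] -> c <> [::] -> w = b ++ c -> (w < (c ++ b : word))%O))
          (lyndon w).
Proof.
apply: (iffP andP) => -[].
  move=> /eqP w0 /allP wP; split=> //; right=> b c b0 c0 wE.
  have /wP : size b \in iota 1 (size w).-1.
    rewrite mem_iota wE size_cat.
    case: b b0 {wE} => // x b _; case: c c0 => // y c _ /=.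
    by rewrite addnS add1n ltnS leq_addr.
  by rewrite [X in drop _ X]wE [X in take _ X]wE drop_size_cat ?take_size_cat.
move=> /eqP w0 wP; split=> //; apply/allP => i; rewrite mem_iota add1n.
case: wP => [-> /=|wP]; first by case: i.
move=> /andP[i0 iw].
have {}iw : (i < size w)%N by case: (w) w0 iw.
apply: wP; last by rewrite cat_take_drop.
  by move/(congr1 size); rewrite size_take iw /=; case: i i0 {iw}.
by move/(congr1 size)/eqP; rewrite size_drop subn_eq0 leqNgt iw.
Qed.

Definition std_factorization (a b c : word) : Prop :=
  [/\ a = b ++ c, lyndon b, lyndon c &
      forall b' c' : word, a = b' ++ c' -> lyndon b' -> lyndon c' ->
        (size c' <= size c)%N].

(* [size b], for [b ++ c] the standard factorization of [a] *)
Definition std_cut (a : word) : nat :=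
  (find (fun i => lyndon (take i a) && lyndon (drop i a))
        (iota 1 (size a).-1)).+1.

Lemma std_cutE (a b c : word) :
  std_factorization a b c -> take (std_cut a) a = b /\ drop (std_cut a) a = c.
Proof.
case=> aE lb lc cmax.
have b0 : (0 < size b)%N by case: (b) lb.
have c0 : (0 < size c)%N by case: (c) lc.
set P := fun i => lyndon (take i a) && lyndon (drop i a).
have sa : size a = (size b + size c)%N by rewrite aE size_cat.
have bin : size b \in iota 1 (size a).-1.
  by rewrite mem_iota b0 add1n prednK sa ?addn_gt0 ?b0 // -addn1 leq_add2l.
have Pb : P (size b) by rewrite /P aE take_size_cat ?drop_size_cat ?lb.
have hasP_ : has P (iota 1 (size a).-1) by apply/hasP; exists (size b).
have cutlt : (find P (iota 1 (size a).-1) < (size a).-1)%N.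
  by rewrite -[X in (_ < X)%N](size_iota 1) -has_find.
have Pcut : P (std_cut a).
  by have := nth_find 0%N hasP_; rewrite nth_iota // add1n.
have cut_le : (std_cut a <= size b)%N.
  rewrite leqNgt; apply/negP => blt.
  have := @before_find _ 0%N P (iota 1 (size a).-1) (size b).-1.
  rewrite -ltnS prednK // => /(_ blt).
  rewrite nth_iota; last first.
    by rewrite sa -ltnS !prednK ?addn_gt0 ?b0 // -addn1 leq_add2l.
  by rewrite add1n prednK // Pb.
have cutE : std_cut a = size b.
  apply/eqP; rewrite eqn_leq cut_le /=.
  case/andP: Pcut => l1 l2.
  have := cmax _ _ (esym (cat_take_drop (std_cut a) a)) l1 l2.
  by rewrite size_drop sa leq_subLR leq_add2r.
by rewrite cutE aE take_size_cat // drop_size_cat.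
Qed.

Section FreeAlgebra.
Variable K : fieldType.

Definition free_carrier := @monalg.malg (monalg.fmonom bool) K.
HB.instance Definition _ := GRing.Lalgebra.on free_carrier.

Let free_scaleAr (a : K) (u v : free_carrier) : a *: (u * v) = u * (a *: v).
Proof.
have central c (w : free_carrier) : monalg.mkmalgU monalg.one c * w
                                   = w * monalg.mkmalgU monalg.one c.
  rewrite [LHS]monalg.fgmulUg [RHS]monalg.fgmulgU.
  by apply: eq_bigr => k _; rewrite mulrC monalg.mul1m monalg.mulm1.
by rewrite -!monalg.mul_malgC !mulrA central.
Qed.

HB.instance Definition _ := isPzAlgebra.Build K free_carrier
  (@scalerA K free_carrier) (@scale1r K free_carrier)
  (@scalerDr K free_carrier) (@scalerDl K free_carrier)
  (@scalerAl K free_carrier) free_scaleAr.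

Definition free_alg : pzAlgType K := free_carrier.

Definition free_gen (x : bool) : free_alg :=
  @monalg.mkmalgU (monalg.fmonom bool) K (monalg.fmu x) 1.
End FreeAlgebra.

Definition commutator (A : pzRingType) (a b : A) : A := a * b - b * a.

Section LyndonBracket.
Variable K : fieldType.

Fixpoint lyndon_bracket_rec (fuel : nat) (w : word) : free_alg K :=
  if fuel isn't fuel'.+1 then 0 else
  if w is [:: x] then free_gen K x else
  commutator (lyndon_bracket_rec fuel' (take (std_cut w) w))
             (lyndon_bracket_rec fuel' (drop (std_cut w) w)).

(* Only meaningful on Lyndon words, see the two lemmas below. *)
Definition lyndon_bracket (w : word) : free_alg K :=
  lyndon_bracket_rec (size w) w.

Lemma lyndon_bracket1 (x : bool) : lyndon_bracket [:: x] = free_gen K x.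
Proof. by []. Qed.

Let rec_nil m : lyndon_bracket_rec m [::] = 0.
Proof. by case: m => //= m; rewrite /commutator subrr. Qed.

Let rec_cons2 m x y (w : seq bool) (v := [:: x, y & w] : word) :
  lyndon_bracket_rec m.+1 v =
  commutator (lyndon_bracket_rec m (take (std_cut v) v))
             (lyndon_bracket_rec m (drop (std_cut v) v)).
Proof. by []. Qed.

Let recE m1 m2 (w : word) : (size w <= m1)%N -> (size w <= m2)%N ->
  lyndon_bracket_rec m1 w = lyndon_bracket_rec m2 w.
Proof.
elim: m1 m2 w => [|m1 IH] m2 w.
  by rewrite leqn0 => /nilP -> _; rewrite !rec_nil.
case: m2 => [|m2]; first by rewrite leqn0 => _ /nilP ->; rewrite !rec_nil.
case: w => [|x [|y w]]; [by rewrite !rec_nil | by [] |].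
have := fun m => @rec_cons2 m x y w.
move: [:: x, y & w] => v vE w1 w2.
have [lt_cut|le_cut] := ltnP (std_cut v) (size v).
  have take_lt : (size (take (std_cut v) v) < size v)%N.
    by rewrite size_take lt_cut.
  have drop_lt : (size (drop (std_cut v) v) < size v)%N.
    by rewrite size_drop ltn_subrL (leq_ltn_trans _ lt_cut).
  rewrite !vE !(IH m2) // -ltnS.
  - exact: leq_trans drop_lt w1.
  - exact: leq_trans drop_lt w2.
  - exact: leq_trans take_lt w1.
  - exact: leq_trans take_lt w2.
rewrite !vE (drop_oversize le_cut) !rec_nil.
by rewrite /commutator !mulr0 !mul0r.
Qed.

Lemma lyndon_bracketE (a b c : word) : std_factorization a b c ->
  lyndon_bracket a = commutator (lyndon_bracket b) (lyndon_bracket c).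
Proof.
move=> abc; have [takeE dropE] := std_cutE abc.
case: abc => aE lb lc _.
have b0 : (0 < size b)%N by case: (b) lb.
have c0 : (0 < size c)%N by case: (c) lc.
have sa : size a = (size b + size c)%N by rewrite aE size_cat.
have sb : (size b <= (size a).-1)%N by rewrite sa -subn1 -addnBA // leq_addr.
have sc : (size c <= (size a).-1)%N.
  by rewrite sa addnC -subn1 -addnBA // leq_addr.
have : (1 < size a)%N by rewrite sa -[2%N]/(1 + 1)%N leq_add.
rewrite {1}/lyndon_bracket; case: a takeE dropE sb sc {aE sa} => [|x [|y a]];
  [by [] | by [] |].
move=> takeE dropE sb sc _; rewrite [size _]/= rec_cons2 takeE dropE.
by rewrite (recE sb (leqnn _)) (recE sc (leqnn _)).
Qed.
End LyndonBracket.

Definition omega (k : nat) : word := gl :: nseq k hl.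

Lemma lyndon_omega k : lyndon (omega k).
Proof.
apply/andP; split=> //; apply/allP => i; rewrite mem_iota /= size_nseq.
case: i => // i /andP[_]; rewrite add1n ltnS => ik.
have -> : drop i.+1 (omega k) = hl :: nseq (k - i.+1) hl.
  by rewrite /= drop_nseq -(subnSK ik).
by [].
Qed.

Lemma lyndon_nseq m : lyndon (nseq m hl) -> (m <= 1)%N.
Proof.
case: m => [|[|m]] // /lyndonP[_ [] // /(_ [:: hl] (nseq m.+1 hl))] wP.
have := wP (fun e => ltac:(by [])) (fun e => ltac:(by [])) erefl.
by rewrite -[[:: hl]]/(nseq 1 hl) -nseqD addn1 ltxx.
Qed.

Lemma lyndon_bracket_omegaS (K : fieldType) k :
  lyndon_bracket K (omega k.+1) =
  commutator (lyndon_bracket K (omega k)) (free_gen K hl).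
Proof.
rewrite -lyndon_bracket1; apply: lyndon_bracketE; split => //.
- by rewrite /omega -addn1 nseqD.
- exact: lyndon_omega.
move=> b' c' bc lb lc; move: bc; case: b' lb => // x b' _ [_ bc].
have cE : c' = nseq (size c') hl.
  apply/all_pred1P; have := all_pred1_nseq hl k.+1.
  by rewrite -[nseq _ _]/(hl :: nseq k hl) bc all_cat => /andP[].
by apply: lyndon_nseq; rewrite -cE.
Qed.

Section Quotients.
Variable K : fieldType.
Notation T := (free_alg K).
Notation E := (@lyndon_bracket K).
Notation g := (free_gen K gl).
Notation h := (free_gen K hl).

(* The maps *_proj are the canonical maps from the free algebra T. *)
Definition Tbar : pzAlgType K :=
  quot_alg [set x : T | exists a : word,
    [/\ lyndon a, (2 <= count_mem gl a)%N & x = E a]].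
Definition Tbar_proj (x : T) : Tbar := quot_proj _ x.

Definition Tbarn (n : nat) : pzAlgType K :=
  quot_alg [set Tbar_proj g ^+ n - 1].
Definition Tbarn_proj n (x : T) : Tbarn n := quot_proj _ (Tbar_proj x).

Definition Tbarn' (n p : nat) : pzAlgType K :=
  quot_alg [set Tbarn_proj n (E (omega p.-1))].
Definition Tbarn'_proj n p (x : T) : Tbarn' n p :=
  quot_proj _ (Tbarn_proj n x).

Definition Tbarnp (n p : nat) : pzAlgType K :=
  quot_alg [set Tbarn'_proj n p h ^+ p].
Definition Tbarnp_proj n p (x : T) : Tbarnp n p :=
  quot_proj _ (Tbarn'_proj n p x).
End Quotients.

(* [h^n2 * E_(p-2)^e_(p-2) * ... * E_1^e_1 * g^n1]; the exponent of [E_k] is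
    the value of [e] at [k - 1]. *)
Definition pbw_monomial (A : pzRingType) (h g : A) (E : nat -> A) (n p : nat)
    (i : 'I_p * {ffun 'I_(p - 2) -> nat} * 'I_n) : A :=
  let: (n2, e, n1) := i in
  h ^+ n2 * (\prod_(j < p - 2) E (rev_ord j).+1 ^+ e (rev_ord j)) * g ^+ n1.

(* Main.v *)
Require Import Defs.
From HB Require Import structures.
From mathcomp Require Import all_boot all_order all_algebra finmap.
From mathcomp Require Import all_classical all_reals all_analysis.
From mathcomp.multinomials Require Import (canonicals) monalg mpoly.
From mathcomp Require Import ring zify.

(** In the quotient, the elements [E_s] commute with each other, and the rule
    [E_s h = h E_s + E_(s+1)] says that commuting with [h] is the derivation
    [D] which sends each [E_s] to [E_(s+1)].  The algebra is therefore the skew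
    polynomial ring in [h] over [K[x_0, ..., x_(p-2)] / (x_0^n - 1)], with [x_s]
    in the place of [E_s], divided by [h^p].  Characteristic [p] makes these
    relations compatible: [D(x_0^n) = n x_0^(n-1) x_1] vanishes because [p]
    divides [n], and [h^p] is central because [D^p], which is again a
    derivation, kills all the variables.

    Relations.  For [s < t] the word [g h^s g h^t] is Lyndon, with standard
    factorization [(g h^s)(g h^t)] ([lyndon_omega_cat],
    [std_factorization_omega_cat]).  Hence the commutator of [E_s] and [E_t] is
    one of the brackets that the first quotient kills.

    Independence.  The free algebra acts on the right of the module of the sums
    of [h^k f_k], with [f_k] in [P = K[x_0, ..., x_(p-2)]]: [g] multiplies by
    [x_0], and [h] sends [h^k f] to [h^(k+1) f + h^k D(f)].  The bracket of a
    Lyndon word acts as multiplication by an element of [P] if the word has one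
    letter [g], and as zero if it has more ([act_bracket_rec]).  Hence all the
    defining relations send the module into its submodule generated by [h^p]
    and [x_0^n - 1] ([Tbarnp_kernel]).  A PBW monomial sends [1] to the
    corresponding [h^a] times a monomial in the variables
    ([act_pbw_monomial]), and these are independent modulo the submodule,
    because a nonzero multiple of [x_0^n - 1] has a monomial of degree at least
    [n] in [x_0] ([multiple_of_xvar0n1]).

    Spanning and growth.  Let [F_N] be the span of the [h^a w], with [w] a
    product of at most [N] elements [E_s].  As [D] does not change the length of
    [w], right multiplication by [h] preserves [F_N], and [F_N F_M] is contained
    in [F_(N+M)] ([filtM]).  Sorting [w] shows that [F_N] is spanned by
    [p n (N+1)^(p-2)] PBW monomials ([filt_span_pbw]), which gives the spanning
    property and the upper bound for the GK-dimension.  For the lower bound, the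
    [k]-th power of the span of the square-free monomials in [E_1, ..., E_(p-2)]
    contains all the monomials with exponents less than [k]
    ([GKdim_pbw_ge]). *)

Set Implicit Arguments.
Unset Strict Implicit.
Unset Printing Implicit Defensive.

Import Order.TTheory GRing.Theory Num.Theory.
Local Open Scope classical_set_scope.
Local Open Scope ring_scope.

(** * Linear algebra and growth *)

Section Subspace.
Variables (K : pzRingType) (V : lmodType K).

Definition lin_subspace (W : set V) : Prop :=
  [/\ W 0, forall x y, W x -> W y -> W (x + y) & forall a x, W x -> W (a *: x)].

Lemma lin_subspace_sum (W : set V) (I : Type) (r : seq I) (P : pred I) (f : I -> V) :
  lin_subspace W -> (forall i, P i -> W (f i)) -> W (\sum_(i <- r | P i) f i).
Proof. by case=> W0 WD _ Wf; apply: big_ind. Qed.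

Lemma subset_lin_span (B : set V) : B `<=` lin_span B.
Proof.
move=> x Bx; exists 1%N, (fun=> x), (fun=> 1); split=> //.
by rewrite big_ord1 scale1r.
Qed.

Lemma lin_span_subspace (B : set V) : lin_subspace (lin_span B).
Proof.
split.
- by exists 0%N, (fun=> 0), (fun=> 0); split=> [[]//|]; rewrite big_ord0.
- move=> _ _ [m [b [c [Bb ->]]]] [m' [b' [c' [Bb' ->]]]].
  exists (m + m')%N, (fun i => match fintype.split i with inl j => b j | inr j => b' j end),
    (fun i => match fintype.split i with inl j => c j | inr j => c' j end); split.
    by move=> i; case: fintype.split.
  rewrite big_split_ord /=; congr (_ + _); apply: eq_bigr => i _.
    by rewrite (unsplitK (inl i)).
  by rewrite (unsplitK (inr i)).
- move=> a _ [m [b [c [Bb ->]]]]; exists m, b, (fun i => a * c i); split=> //.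
  by rewrite scaler_sumr; apply: eq_bigr => i _; rewrite scalerA.
Qed.

Lemma lin_span_sub (B W : set V) : lin_subspace W -> B `<=` W -> lin_span B `<=` W.
Proof.
move=> sW BW _ [m [b [c [Bb ->]]]]; apply: lin_subspace_sum => // i _.
by case: sW => _ _; apply; apply: BW.
Qed.

Lemma lin_spanS (B C : set V) : B `<=` C -> lin_span B `<=` lin_span C.
Proof.
move=> BC; apply: lin_span_sub; first exact: lin_span_subspace.
exact: subset_trans BC (@subset_lin_span C).
Qed.

Lemma lin_span_finP (J : finType) (v : J -> V) x :
  lin_span (range v) x -> exists c : J -> K, x = \sum_j c j *: v j.
Proof.
apply: (@lin_span_sub _ [set x | exists c : J -> K, x = \sum_j c j *: v j]).
  split.
  - by exists (fun=> 0); rewrite big1 // => j _; rewrite scale0r.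
  - move=> _ _ [c ->] [d ->]; exists (fun j => c j + d j).
    by rewrite -big_split /=; apply: eq_bigr => j _; rewrite scalerDl.
  - move=> a _ [c ->]; exists (fun j => a * c j).
    by rewrite scaler_sumr; apply: eq_bigr => j _; rewrite scalerA.
move=> _ [j _ <-]; exists (fun i => (i == j)%:R).
rewrite (bigD1 j) //= eqxx scale1r big1 ?addr0 // => i /negPf ->.
by rewrite scale0r.
Qed.

Lemma lin_indep_comp (I J : choiceType) (b : I -> V) (f : J -> I) :
  injective f -> lin_indep b -> lin_indep (b \o f).
Proof.
move=> injf indb s c us sum0 j js.
pose c' i := c (nth j s (index i (map f s))).
have c'E k : k \in s -> c' (f k) = c k.
  by move=> ks; rewrite /c' nth_index_map // => k1 k2 _ _; apply: injf.
rewrite -c'E //; apply: (indb (map f s)); rewrite ?map_inj_uniq ?map_f //.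
by rewrite big_map -[RHS]sum0; apply: eq_big_seq => k /c'E ->.
Qed.
End Subspace.

Section Dimension.
Variables (K : fieldType) (V : lmodType K).

(** The coefficients of the [b i] on the [v j] form a matrix; if it had more rows
    than columns, a vector of its left kernel would be a dependency. *)
Lemma lin_indep_card (J : finType) (v : J -> V) (m : nat) (b : 'I_m -> V) :
  lin_indep b -> (forall i, lin_span (range v) (b i)) -> (m <= #|J|)%N.
Proof.
move=> indb spb; rewrite leqNgt; apply/negP => ltJm.
have /choice[c bE] : forall i, exists c : J -> K, b i = \sum_j c j *: v j.
  by move=> i; apply: lin_span_finP.
pose C := \matrix_(i < m, j < #|J|) c i (enum_val j).
have : kermx C != 0.
  rewrite kermx_eq0 /row_free ltn_eqF //.
  exact: leq_ltn_trans (rank_leq_col _) ltJm.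
case/rowV0Pn => u /sub_kermxP uC /rV0Pn[i0 ui0]; case/negP: ui0; apply/eqP.
apply: (indb (index_enum 'I_m) (fun i => u 0 i)); rewrite ?index_enum_uniq ?mem_index_enum //.
under eq_bigr => i _ do rewrite bE scaler_sumr.
rewrite exchange_big big1 //= => j _.
under eq_bigr => i _ do rewrite scalerA.
rewrite -scaler_suml.
have := congr1 (fun M : 'rV_ _ => M 0 (enum_rank j)) uC; rewrite !mxE => uCj.
rewrite (_ : \sum_(i < m) _ = 0) ?scale0r // -[RHS]uCj.
by apply: eq_bigr => i _; rewrite mxE enum_rankK.
Qed.

Variable R : realType.

Lemma lin_dim_ge0 (U : set V) : (0 <= lin_dim R U)%E.
Proof.
apply: ereal_sup_ubound; exists 0%N => //; exists (fun=> 0); split=> [[]//|].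
by move=> s c _ _ [].
Qed.

Lemma lin_dim_le (J : finType) (v : J -> V) (U : set V) :
  U `<=` lin_span (range v) -> (lin_dim R U <= #|J|%:R%:E)%E.
Proof.
move=> Uv; apply: ge_ereal_sup => _ [m [b [Ub indb]] <-].
rewrite lee_fin ler_nat; apply: lin_indep_card indb _ => i.
by apply: Uv.
Qed.

Lemma lin_dim_ge (J : finType) (v : J -> V) (U : set V) :
  lin_indep v -> (forall j, U (v j)) -> (#|J|%:R%:E <= lin_dim R U)%E.
Proof.
move=> indv Uv; apply: ereal_sup_ubound; exists #|J| => //.
exists (v \o enum_val); split=> [i|]; first exact: Uv.
by apply: lin_indep_comp => //; apply: enum_val_inj.
Qed.
End Dimension.

Lemma lin_span_linear (K : pzRingType) (V W : lmodType K) (f : {linear V -> W})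
  (I : Type) (b : I -> V) v :
  lin_span (range b) v -> lin_span (range (f \o b)) (f v).
Proof.
move=> [k [u [c [bu ->]]]]; exists k, (f \o u), c; split=> [i|].
  by have [j _ bj] := bu i; exists j; rewrite //= bj.
by rewrite linear_sum; apply: eq_bigr => i _; rewrite linearZ_LR.
Qed.

Lemma lin_spanM (K : fieldType) (A : pzAlgType K) (B C W : set A) x y :
  lin_subspace W -> (forall b c, B b -> C c -> W (b * c)) ->
  lin_span B x -> lin_span C y -> W (x * y).
Proof.
move=> sW BCW Bx Cy; have [W0 WD WZ] := sW.
have sub1 z : lin_subspace [set u : A | W (u * z)].
  split=> [|u v /= Wu Wv|a u /= Wu]; rewrite /= ?mul0r ?mulrDl //; first exact: WD.
  by rewrite [_ * _](esym (pz_scaleAl a u z)); apply: WZ.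
have sub2 z : lin_subspace [set u : A | W (z * u)].
  split=> [|u v /= Wu Wv|a u /= Wu]; rewrite /= ?mulr0 ?mulrDr //; first exact: WD.
  by rewrite [_ * _](esym (pz_scaleAr a z u)); apply: WZ.
apply: (lin_span_sub (sub1 y) _ Bx) => b Bb /=.
by apply: (lin_span_sub (sub2 b) _ Cy) => c Cc /=; apply: BCW.
Qed.

Section GrowthRate.
Variables (K : fieldType) (A : pzAlgType K) (R : realType) (r : nat).

(** The lower bound is asked for every [m], not only asymptotically: the quotient
    of logarithms is then at least [r] at each [m >= 2], and no limit has to be
    computed. *)
Lemma GKdim_ge (V : set A) : fin_dim_subspace V ->
  (forall m, ((m ^ r)%:R%:E <= lin_dim R (sum_powers V m))%E) ->
  (r%:R%:E <= GKdim A R)%E.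
Proof.
move=> fdV Vr; apply: le_ereal_sup_tmp; eexists; first by exists V.
apply: le_ereal_inf_tmp => _ [B [N _ NB] <-].
set m := maxn N 2; apply: le_ereal_sup_tmp.
exists (lne (lin_dim R (sum_powers V m)) * ((ln m%:R)^-1)%:E)%E.
  by exists m => //; apply: NB; rewrite /= leq_maxl.
have m2 : (2 <= m)%N by rewrite leq_maxr.
have lnm : 0 < ln (m%:R : R) by rewrite ln_gt0 // ltr1n.
have -> : (r%:R%:E = (r%:R * ln (m%:R : R))%:E * ((ln m%:R)^-1)%:E :> \bar R)%E.
  by rewrite -EFinM mulfK // gt_eqF.
apply: lee_wpmul2r; first by rewrite lee_fin invr_ge0 ltW.
rewrite mulr_natl -lnXn ?ltr0n ?(leq_trans _ m2) // -lne_EFin; last first.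
  by rewrite exprn_gt0 // ltr0n (leq_trans _ m2).
rewrite lee_lne ?in_itv /= ?leey ?andbT ?lin_dim_ge0 ?lee_fin ?exprn_ge0 //.
by rewrite -natrX; apply: Vr.
Qed.

(** As [d m + 1 <= (d + 1) m] for [m > 0], the logarithm of the bound is at most
    [r ln m] plus a constant [C], which is at most [e ln m] for [m] large. *)
Lemma GKdim_le :
  (forall V : set A, fin_dim_subspace V -> exists c d : nat, (0 < c)%N /\
     forall m, (lin_dim R (sum_powers V m) <= (c * (d * m).+1 ^ r)%:R%:E)%E) ->
  (GKdim A R <= r%:R%:E)%E.
Proof.
move=> AU; apply: ge_ereal_sup => _ [V /AU[c [d [c0 Vcd]]] <-].
pose C : R := ln (c * d.+1 ^ r)%:R.
have C0 : 0 <= C by rewrite ln_ge0 // ler1n muln_gt0 c0 expn_gt0.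
apply/lee_addgt0Pr => e e0.
have [N NC] : exists N : nat, forall m, (N <= m)%N -> C <= e * ln (m%:R : R).
  exists (Num.truncn (expR (C / e))).+1 => m Nm.
  have lt_m : expR (C / e) <= m%:R.
    by apply/ltW/(lt_le_trans (truncnS_gt _)); rewrite ler_nat.
  rewrite mulrC -ler_pdivrMr // -ler_expR lnK // posrE.
  exact: lt_le_trans (expR_gt0 _) lt_m.
apply: ge_ereal_inf; exists (ereal_sup [set (lne (lin_dim R (sum_powers V m)) *
    ((ln m%:R)^-1)%:E)%E | m in [set m | (maxn N 2 <= m)%N]]).
  by exists [set m | (maxn N 2 <= m)%N] => //; exists (maxn N 2).
apply: ge_ereal_sup => _ [m /= + <-]; rewrite geq_max => /andP[Nm m2].
have m0 : (0 < m)%N by apply: leq_trans m2.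
have lnm : 0 < ln (m%:R : R) by rewrite ln_gt0 // ltr1n.
rewrite -EFinD; set x := (r%:R + e)%R.
have -> : (x%:E = (x * ln (m%:R : R))%:E * ((ln m%:R)^-1)%:E :> \bar R)%E.
  by rewrite -EFinM mulfK // gt_eqF.
apply: lee_wpmul2r; first by rewrite lee_fin invr_ge0 ltW.
apply: (@le_trans _ _ (lne (c * d.+1 ^ r * m ^ r)%:R%:E)).
  rewrite lee_lne ?in_itv /= ?leey ?andbT ?lin_dim_ge0 ?lee_fin ?ler0n //.
  apply: le_trans (Vcd m) _; rewrite lee_fin ler_nat -mulnA -expnMn leq_mul2l.
  apply/orP; right; case: (posnP r) => [->|r0]; first by rewrite !expn0.
  by rewrite leq_exp2r // mulSn -addn1 addnC leq_add2r.
rewrite lne_EFin ?ltr0n ?muln_gt0 ?c0 ?expn_gt0 ?m0 //.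
rewrite lee_fin natrM lnM ?posrE ?ltr0n ?muln_gt0 ?c0 ?expn_gt0 ?m0 //.
rewrite natrX lnXn ?ltr0n // -[ln _ *+ r]mulr_natl /x mulrDl addrC lerD2l.
exact: NC.
Qed.
End GrowthRate.

(** * Ideals of quotient algebras *)

Section QuotientKernel.
Variables (K : pzRingType) (A : pzAlgType K).

Lemma gen_ideal_sub (S I : set A) :
  two_sided_ideal I -> S `<=` I -> gen_ideal S `<=` I.
Proof. by move=> idI SI x; apply; split. Qed.

Lemma mem_gen_ideal (S : set A) x : S x -> gen_ideal S x.
Proof. by move=> Sx I [_]; apply. Qed.

Lemma quot_proj_eq0 (S : set A) x : S x -> quot_proj S x = 0.
Proof.
move=> Sx; rewrite -(rmorph0 (quot_proj S)); apply/quot_projP.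
by rewrite subr0; apply: mem_gen_ideal.
Qed.

(** An ideal which contains [S] is saturated for the projection.  Together with
    [two_sided_ideal_image], this carries an ideal through a tower of quotients,
    one step at a time. *)
Lemma quot_proj_kernel (S I : set A) x : two_sided_ideal I -> S `<=` I ->
  I (x : A) -> forall y, quot_proj S y = quot_proj S x -> I y.
Proof.
move=> idI SI Ix y /quot_projP /(gen_ideal_sub idI SI) Iyx.
by rewrite -(subrK x y); case: idI => _ ID _ _; apply: ID.
Qed.

Lemma two_sided_ideal_image (S I : set A) :
  two_sided_ideal I -> two_sided_ideal (quot_proj S @` I).
Proof.
case=> I0 ID IMl IMr; split.
- by exists 0; rewrite ?rmorph0.
- move=> _ _ [x Ix <-] [y Iy <-]; exists (x + y); [exact: ID | exact: rmorphD].
- move=> a _ [x Ix <-]; have [b <-] := quot_proj_surj a.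
  by exists (b * x); [exact: IMl | rewrite rmorphM].
- move=> a _ [x Ix <-]; have [b <-] := quot_proj_surj a.
  by exists (x * b); [exact: IMr | rewrite rmorphM].
Qed.

End QuotientKernel.

(** * The free algebra and its right modules *)

Section FreeAlgebra.
Variable K : fieldType.
Implicit Types x y : free_alg K.

Definition free_word (w : seq bool) : free_alg K := \prod_(b <- w) free_gen K b.

Lemma free_wordE (w : monalg.fmonom bool) :
  free_word (monalg.fmonom_val w) = @monalg.mkmalgU (monalg.fmonom bool) K w 1.
Proof.
case: w => w; elim: w => [|b w IH].
  rewrite /free_word big_nil; change (monalg.mkmalgU monalg.one 1 =
   (@monalg.mkmalgU (monalg.fmonom bool) K (monalg.FMonom [::]) 1)).
  by rewrite /monalg.one /= monalg.fmoneE.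
rewrite /free_word /= big_cons -[X in _ * X]/(free_word (monalg.fmonom_val (monalg.FMonom w))) IH.
rewrite /free_gen [LHS]monalg.fgmulUU mul1r; congr monalg.mkmalgU.
by apply/eqP; rewrite monalg.fmP monalg.fmM monalg.fmU.
Qed.

Lemma free_alg_sum x :
  x = \sum_(w <- monalg.msupp x)
        monalg.mcoeff w x *: free_word (monalg.fmonom_val w).
Proof.
rewrite [LHS]monalg.monalgE; apply: eq_bigr => w _; rewrite free_wordE.
apply/monalg.malgP => u; rewrite [RHS]monalg.mcoeffZ [LHS]monalg.mcoeffU.
by rewrite [in RHS]monalg.mcoeffU mulrnAr mulr1.
Qed.

Lemma free_alg_span x : lin_span (range free_word) x.
Proof.
have [_ _ spanZ] := lin_span_subspace (range free_word).
rewrite (free_alg_sum x); apply: lin_subspace_sum; first exact: lin_span_subspace.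
by move=> w _; apply: spanZ; apply: subset_lin_span; exists (monalg.fmonom_val w).
Qed.

Lemma rmorph_free_word (B : pzRingType)
    (f : {rmorphism free_alg K -> B}) w :
  f (free_word w) =
  \prod_(b <- w) (if b then f (free_gen K hl) else f (free_gen K gl)).
Proof. by rewrite rmorph_prod; apply: eq_bigr => -[]. Qed.
End FreeAlgebra.

Section FreeAction.
Variables (K : fieldType) (V : lmodType K) (gen_op : bool -> {linear V -> V}).

Definition word_act (w : seq bool) (v : V) : V := foldl (fun u b => gen_op b u) v w.

Lemma word_act_linear w : linear (word_act w).
Proof. by elim: w => [//|b w IH] a u v; rewrite /word_act /= linearP; apply: IH. Qed.

HB.instance Definition _ w :=
  GRing.isLinear.Build K V V *:%R (word_act w) (@word_act_linear w).

(** The action is on the right because the PBW monomials begin with their power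
    of [h]: multiplying [h^k f] by [h] on the right takes a single application of
    the derivation, whereas multiplying it by [f] on the left takes [k] of them. *)
Definition ract (x : free_alg K) (v : V) : V :=
  \sum_(w <- monalg.msupp x) monalg.mcoeff w x *: word_act (monalg.fmonom_val w) v.

Lemma ractEw (d : {fset monalg.fmonom bool}) x v :
  (monalg.msupp x `<=` d)%fset ->
  ract x v = \sum_(w <- d) monalg.mcoeff w x *: word_act (monalg.fmonom_val w) v.
Proof.
move=> xd; rewrite /ract (big_fset_incl _ xd) // => w wd /monalg.mcoeff_outdom ->.
by rewrite scale0r.
Qed.

Lemma ract_linearl v : linear (ract^~ v).
Proof.
move=> a x y /=.
pose d := (monalg.msupp x `|` monalg.msupp y `|` monalg.msupp (a *: x + y))%fset.
rewrite !(@ractEw d).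
- rewrite scaler_sumr -big_split; apply: eq_bigr => w _ /=.
  by rewrite scalerA -scalerDl linearP.
- by rewrite /d -fsetUA fsetUCA fsubsetUl.
- by rewrite /d -fsetUA fsubsetUl.
- by rewrite /d fsubsetUr.
Qed.

Lemma ract_linearr x : linear (ract x).
Proof.
move=> a u v; rewrite /ract scaler_sumr -big_split; apply: eq_bigr => w _ /=.
by rewrite linearP scalerDr !scalerA mulrC.
Qed.

HB.instance Definition _ x :=
  GRing.isLinear.Build K V V *:%R (ract x) (@ract_linearr x).
(** The arguments of [ract] in the order that lets it carry an instance of
    linearity in the algebra element. *)
Definition ract_at (v : V) (x : free_alg K) : V := ract x v.

HB.instance Definition _ v :=
  GRing.isLinear.Build K (free_alg K) V *:%R (ract_at v) (@ract_linearl v).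

Lemma ract0l v : ract 0 v = 0.
Proof. exact: (linear0 (ract_at v)). Qed.

Lemma ractDl x y v : ract (x + y) v = ract x v + ract y v.
Proof. exact: (linearD (ract_at v)). Qed.

Lemma ractZl a x v : ract (a *: x) v = a *: ract x v.
Proof. exact: (linearZ_LR (ract_at v)). Qed.

Lemma ractBl x y v : ract (x - y) v = ract x v - ract y v.
Proof. exact: (linearB (ract_at v)). Qed.

Lemma ractDr x u v : ract x (u + v) = ract x u + ract x v.
Proof. exact: linearD. Qed.

Lemma ractZr a x v : ract x (a *: v) = a *: ract x v.
Proof. exact: linearZ_LR. Qed.

Lemma ract0r x : ract x 0 = 0.
Proof. exact: linear0. Qed.

Lemma ract_word w v : ract (free_word K w) v = word_act w v.
Proof.
have -> : w = monalg.fmonom_val (monalg.FMonom w) by [].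
rewrite free_wordE (@ractEw [fset monalg.FMonom w]%fset).
  by rewrite big_seq_fset1 monalg.mcoeffUU scale1r.
exact: monalg.msuppU_le.
Qed.

Lemma ract_gen b v : ract (free_gen K b) v = gen_op b v.
Proof. by have := ract_word [:: b] v; rewrite /free_word big_seq1. Qed.

Lemma ract1 v : ract 1 v = v.
Proof. by have := ract_word [::] v; rewrite /free_word big_nil. Qed.

Lemma ractM x y v : ract (x * y) v = ract y (ract x v).
Proof.
move: x v; pose W y := [set x | forall v, ract (x * y) v = ract y (ract x v)].
have subW z : lin_subspace (W z).
  split=> [v|s t Ws Wt v|a s Ws v].
  - by rewrite mul0r !ract0l linear0.
  - have e1 : ract ((s + t) * z) v = ract (s * z) v + ract (t * z) v.
      by rewrite mulrDl; exact: ractDl.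
    have e2 : ract z (ract (s + t) v) = ract z (ract s v) + ract z (ract t v).
      exact: etrans (congr1 (ract z) (ractDl s t v)) (ractDr _ _ _).
    exact: etrans e1 (etrans (congr2 +%R (Ws v) (Wt v)) (esym e2)).
  - have e1 : ract (a *: s * z) v = a *: ract (s * z) v.
      exact: etrans (congr1 (ract^~ v) (esym (pz_scaleAl a s z))) (ractZl _ _ _).
    have e2 : ract z (ract (a *: s) v) = a *: ract z (ract s v).
      exact: etrans (congr1 (ract z) (ractZl a s v)) (ractZr _ _ _).
    exact: etrans e1 (etrans (congr1 ( *:%R a) (Ws v)) (esym e2)).
move=> x; apply: (lin_span_sub (subW y) _ (free_alg_span x)) => _ [w _ <-].
pose W' := [set y | forall v, ract (free_word K w * y) v =
                              ract y (ract (free_word K w) v)].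
have subW' : lin_subspace W'.
  split=> [v|s t Ws Wt v|a s Ws v].
  - by rewrite mulr0 !ract0l.
  - have e1 : ract (free_word K w * (s + t)) v =
              ract (free_word K w * s) v + ract (free_word K w * t) v.
      by rewrite mulrDr; exact: ractDl.
    exact: etrans e1 (etrans (congr2 +%R (Ws v) (Wt v)) (esym (ractDl s t _))).
  - have e1 : ract (free_word K w * (a *: s)) v = a *: ract (free_word K w * s) v.
      exact: etrans (congr1 (ract^~ v) (esym (pz_scaleAr a _ s))) (ractZl _ _ _).
    exact: etrans e1 (etrans (congr1 ( *:%R a) (Ws v)) (esym (ractZl a s _))).
apply: (lin_span_sub subW' _ (free_alg_span y)) => _ [u _ <-] {}v.
rewrite /free_word -big_cat -!/(free_word _ _) !ract_word.
exact: foldl_cat.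
Qed.

End FreeAction.

(** * Lyndon words *)

Lemma lyndon_count0 (w : word) : lyndon w -> count_mem gl w = 0%N -> w = [:: hl].
Proof.
move=> lw w0; have wE : w = nseq (size w) hl.
  apply/all_pred1P; rewrite -[all _ _]negbK -has_predC; apply/negP.
  rewrite has_count => /prednK; rewrite (eq_count (a2 := pred1 gl)) ?w0 //.
  by case.
move: lw (lw); rewrite {1}wE => /lyndon_nseq; rewrite wE size_nseq.
by case: (size w) => [|[|n]].
Qed.

(** When no cut gives two Lyndon words, the search runs to the end of its range,
    so that [std_cut w] is the size of [w]; the right part is then empty, and the
    bracket of [w] is zero. *)
Lemma std_cutP (w : word) : (1 < size w)%N ->
  drop (std_cut w) w = [::] \/
  [/\ lyndon (take (std_cut w) w), lyndon (drop (std_cut w) w) &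
      (std_cut w < size w)%N].
Proof.
move=> w2; pose P i := lyndon (take i w) && lyndon (drop i w).
have w1 : (0 < (size w).-1)%N by rewrite -ltnS prednK // ltnW.
have [cut|nocut] := boolP (has P (iota 1 (size w).-1)); last first.
  left; apply: drop_oversize.
  by rewrite /std_cut (hasNfind nocut) size_iota prednK // ltnW.
have find_lt : (find P (iota 1 (size w).-1) < (size w).-1)%N.
  by rewrite -[X in (_ < X)%N](size_iota 1) -has_find.
have := nth_find 0%N cut; rewrite nth_iota // add1n => /andP[lu lt].
by right; split=> //; rewrite /std_cut -ltnS prednK // ltnW in find_lt *.
Qed.

Lemma lyndon_bracket_rec_nil (K : fieldType) fuel : lyndon_bracket_rec K fuel [::] = 0.
Proof. by case: fuel => //= fuel; rewrite /commutator subrr. Qed.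

(** The words first differ at position [a + 1], where the left one has [g] and the
    right one has [h]. *)
Lemma omega_cat_lt a b (u v : seq bool) : (a < b)%N ->
  ((omega a ++ gl :: u : word) < (omega b ++ v : word))%O.
Proof.
move=> lt_ab; rewrite /omega -(subnKC lt_ab) addSn -addnS nseqD /= -catA.
have pref k (s t : seq bool) : ((s : word) < (t : word))%O ->
    ((nseq k hl ++ s : word) < (nseq k hl ++ t : word))%O.
  by move=> st; elim: k => [//|k IH]; rewrite /= ltxi_cons lexx.
by rewrite ltxi_cons lexx /= pref.
Qed.

(** All the proper rotations start with [h], except the one at the second [g],
    where [a < b] decides. *)
Lemma lyndon_omega_cat a b : (a < b)%N -> lyndon (omega a ++ omega b).
Proof.
move=> lt_ab; apply/andP; split=> //; apply/allP => i iw.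
have {iw}[i0 iw] : (0 < i)%N /\ (i < a.+1 + b.+1)%N.
  by move: iw; rewrite mem_iota size_cat /= !size_nseq => /andP[]; lia.
have [->|ia] := eqVneq i a.+1.
  rewrite drop_size_cat ?take_size_cat /= ?size_nseq //.
  exact: omega_cat_lt.
rewrite (drop_nth gl); last by rewrite size_cat /= !size_nseq; lia.
suff -> : nth gl (omega a ++ omega b) i = hl by [].
rewrite nth_cat /= size_nseq ltnS; case: leqP => ai.
  by case: i i0 ai {iw ia} => // i _ ia; rewrite /= nth_nseq ia.
case: (i - a.+1)%N (subnKC ai) iw => [|k] iE iw; first by rewrite -iE addn0 eqxx in ia.
by rewrite /= nth_nseq ifT //; lia.
Qed.

(** A longer right factor would start with [h] and still contain the second [g],
    so that its rotation starting at this [g] would be smaller. *)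
Lemma std_factorization_omega_cat a b :
  std_factorization (omega a ++ omega b) (omega a) (omega b).
Proof.
split=> //; try exact: lyndon_omega.
move=> u v wE lu lv; rewrite leqNgt; apply/negP => bv.
have u0 : (0 < size u)%N by case: (u) lu.
have := congr1 size wE; rewrite !size_cat => sizeE.
have ua : (size u < size (omega a))%N.
  by rewrite -(ltn_add2r (size (omega b))) sizeE ltn_add2l.
have vE : v = drop (size u) (omega a) ++ omega b.
  by rewrite -(drop_size_cat v (erefl (size u))) -wE drop_cat ua.
move/lyndonP: lv => [_ [v1|]]; first by rewrite v1 in bv.
have [k dE] : exists k, drop (size u) (omega a) = hl :: nseq k hl.
  case: (size u) u0 ua => // k _; rewrite /= ltnS size_nseq => ka.
  by exists (a - k.+1)%N; rewrite drop_nseq -(subnSK ka).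
move=> /(_ (hl :: nseq k hl) (omega b)); rewrite vE dE => lt_rot.
have := lt_rot (fun e => ltac:(by [])) (fun e => ltac:(by [])) erefl.
by rewrite ltxi_cons.
Qed.

(** * A right module killed by the relations *)

Section Pascal.
Variables (V : zmodType) (Phi : {additive V -> V}) (T : nat -> nat -> V).
Hypothesis PhiT : forall i j, Phi (T i j) = T i.+1 j + T i j.+1.

(** The common pattern of two binomial formulas: the Leibniz rule for the powers
    of a derivation, with [T i j = D^i a * D^j b], and the expansion of the powers
    of a sum of two commuting operators, with [T i j = f^i (g^j v)]. *)
Lemma iter_pascal k :
  iter k Phi (T 0 0) = \sum_(i < k.+1) T i (k - i)%N *+ 'C(k, i).
Proof.
elim: k => [|k IH]; first by rewrite big_ord1 bin0.
rewrite iterS IH raddf_sum.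
under eq_bigr => i _ do rewrite raddfMn PhiT mulrnDl.
rewrite big_split /= addrC big_ord_recl [RHS]big_ord_recl /= !bin0 subn0 -addrA.
congr (_ + _).
rewrite [X in _ + X]big_ord_recr [RHS]big_ord_recr /= !binn subnn addrA.
congr (_ + _); last by rewrite /bump add1n subSS subnn.
rewrite -big_split; apply: eq_bigr => i _ /=.
by rewrite /bump !add1n subSS binS mulrnDr subnSK.
Qed.

Lemma iter_pascal_prime p :
  prime p -> (forall v : V, v *+ p = 0) ->
  iter p Phi (T 0 0) = T p 0%N + T 0%N p.
Proof.
case: p => [//|p] pr_p pV; rewrite iter_pascal big_ord_recl big_ord_recr /=.
rewrite /bump !add1n bin0 subn0 subnn binn big1 ?add0r 1?addrC // => i _.
have /dvdnP[q ->] : (p.+1 %| 'C(p.+1, i.+1))%N.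
  by apply: prime_dvd_bin; rewrite ?ltnS ?ltn_ord.
by rewrite mulrnA pV.
Qed.
End Pascal.

Lemma mulrn_pchar (K : fieldType) (V : lmodType K) p (v : V) :
  p \in [pchar K] -> v *+ p = 0.
Proof. by move=> /pcharf0 p0; rewrite -scaler_nat p0 scale0r. Qed.

Section Model.
Variables (K : fieldType) (P : comAlgType K) (D : {linear P -> P}).
Variable x : nat -> P.
Hypothesis DM : forall a b, D (a * b) = D a * b + a * D b.
Hypothesis Dx : forall s, D (x s) = x s.+1.

Local Notation V := (nat -> P).

(** A sequence [v] stands for the sum of the [h^k v_k].  Right multiplication by
    [c] is then [mulop c], and right multiplication by [h] is [skew], since
    [f h = h f + D(f)]. *)
Definition mulop (c : P) (v : V) : V := fun k => c * v k.
Definition shift (v : V) : V := fun k => if k is k'.+1 then v k' else 0.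
Definition skew (v : V) : V := fun k => shift v k + D (v k).

Let addE (u v : V) k : (u + v) k = u k + v k. Proof. by []. Qed.
Let oppE (v : V) k : (- v) k = - v k. Proof. by []. Qed.
Let scaleE a (v : V) k : (a *: v) k = a *: v k. Proof. by []. Qed.

Lemma mulop_linear c : linear (mulop c).
Proof.
by move=> a u v; apply/funext => k; rewrite /mulop !(addE, scaleE) mulrDr -scalerAr.
Qed.

Lemma shift_linear : linear shift.
Proof.
move=> a u v; apply/funext => -[|k]; rewrite !(addE, scaleE) //=.
by rewrite scaler0 addr0.
Qed.

Lemma skew_linear : linear skew.
Proof.
move=> a u v; apply/funext => k; rewrite /skew shift_linear !(addE, scaleE).
by rewrite linearP scalerDr addrACA.
Qed.

HB.instance Definition _ c := GRing.isLinear.Build K V V *:%R (mulop c) (mulop_linear c).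
HB.instance Definition _ := GRing.isLinear.Build K V V *:%R skew skew_linear.

Definition gen_op (b : bool) : {linear V -> V} :=
  if b then skew : {linear V -> V} else mulop (x 0) : {linear V -> V}.

Local Notation act := (ract gen_op).

Lemma skew_mulop c v : skew (mulop c v) - mulop c (skew v) = mulop (D c) v.
Proof.
apply/funext => k; rewrite addE oppE /skew /mulop mulrDr DM.
have -> : shift (fun k0 => c * v k0) k = c * shift v k.
  by case: k => [|k] //=; rewrite mulr0.
by ring.
Qed.

Lemma act_commutator y z v :
  act (commutator y z) v = act z (act y v) - act y (act z v).
Proof.
rewrite -(ractM _ y z) -(ractM _ z y); exact: ractBl.
Qed.

Lemma act_bracket_omega s v :
  act (lyndon_bracket K (omega s)) v = mulop (x s) v.
Proof.
elim: s v => [|s IH] v; first by rewrite ract_gen.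
by rewrite lyndon_bracket_omegaS act_commutator !IH !ract_gen skew_mulop Dx.
Qed.

(** Only the number of letters [g] matters.  A Lyndon word without [g] is [h].
    The commutator of a multiplication and [skew] is a multiplication by
    [skew_mulop], two multiplications commute, and a commutator with zero is
    zero.  The statement is about the recursion with an arbitrary amount of fuel
    because the two parts of a word may be evaluated with more fuel than their
    size. *)
Lemma act_bracket_rec fuel (w : word) : lyndon w -> (size w <= fuel)%N ->
  [/\ count_mem gl w = 0%N ->
        forall v, act (lyndon_bracket_rec K fuel w) v = skew v,
      count_mem gl w = 1%N ->
        exists c, forall v, act (lyndon_bracket_rec K fuel w) v = mulop c v &
      (2 <= count_mem gl w)%N ->
        forall v, act (lyndon_bracket_rec K fuel w) v = 0].
Proof.
elim: fuel w => [|fuel IH] w lw; first by rewrite leqn0 => /nilP w0; move: lw; rewrite w0.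
case: (eqVneq (size w) 1%N) => [w1 _|w1 wf].
  case: w w1 {lw} => [//|b [|//]] _ /=.
  split; [by case: b => // _ v; rewrite ract_gen | | by case: b].
  by case: b => // _; exists (x 0) => v; rewrite ract_gen.
have {w1} w2 : (1 < size w)%N by case: (w) lw w1 => [|? []].
have -> : lyndon_bracket_rec K fuel.+1 w =
   commutator (lyndon_bracket_rec K fuel (take (std_cut w) w))
             (lyndon_bracket_rec K fuel (drop (std_cut w) w)).
  by case: (w) w2 => [|? []].
set u := take _ w; set t := drop _ w.
have w0 : count_mem gl w <> 0%N by move/(lyndon_count0 lw) => w1; rewrite w1 in w2.
have [t0|[lu lt cut_lt]] := std_cutP w2.
  rewrite /t t0 lyndon_bracket_rec_nil /commutator mulr0 mul0r subrr.
  split=> // [_|_ v]; last exact: ract0l.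
  by exists 0 => v; rewrite ract0l; apply/funext => k; rewrite /mulop mul0r.
have cut0 : (0 < std_cut w)%N by [].
have uf : (size u <= fuel)%N by rewrite -ltnS (leq_trans _ wf) // size_takel // ltnW.
have tf : (size t <= fuel)%N.
  by rewrite -ltnS (leq_trans _ wf) // size_drop ltn_subrL cut0 ltnW.
have [u0 u1 u2] := IH _ lu uf; have [t0 t1 t2] := IH _ lt tf.
have cw : count_mem gl w = (count_mem gl u + count_mem gl t)%N.
  by rewrite -count_cat cat_take_drop.
move: (count_mem gl w) (count_mem gl u) (count_mem gl t) cw w0 u0 u1 u2 t0 t1 t2.
move=> cw cu ct cwE w0.
move: (lyndon_bracket_rec K fuel u) (lyndon_bracket_rec K fuel t).
move=> eu et u0 u1 u2 t0 t1 t2; split; [by move/w0 | |]; rewrite cwE; last first.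
  move=> cut2; case: (ltnP 1 cu) => [/u2 eu0 v|cu1].
    by rewrite act_commutator !eu0 ract0r subrr.
  case: (ltnP 1 ct) => [/t2 et0 v|ct1].
    by rewrite act_commutator !et0 ract0r subrr.
  have [|c uc] := u1; first by lia.
  have [|d td] := t1; first by lia.
  move=> v; rewrite act_commutator !uc !td; apply/funext => k.
  by rewrite addE oppE /mulop mulrCA subrr.
have [cu0|cu1] := posnP cu => cut1.
  have [|c tc] := t1; first by lia.
  exists (- D c) => v; rewrite act_commutator !tc !u0 // -[LHS]opprB skew_mulop.
  by apply/funext => k; rewrite oppE /mulop mulNr.
have [|c uc] := u1; first by lia.
by exists (D c) => v; rewrite act_commutator !uc !t0 ?skew_mulop //; lia.
Qed.

Lemma iter_shift i (v : V) k :
  iter i shift v k = if (k < i)%N then 0 else v (k - i)%N.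
Proof.
elim: i k => [|i IH] k; first by rewrite subn0.
by case: k => [//|k]; rewrite iterS /= IH ltnS subSS.
Qed.

Lemma derivation1 : D 1 = 0.
Proof. by have := DM 1 1; rewrite !mulr1 mul1r -{1}[D 1]add0r => /addIr. Qed.

Lemma derivation_exp a m : D (a ^+ m) = (a ^+ m.-1 * D a) *+ m.
Proof.
elim: m => [|m IH]; first by rewrite derivation1.
rewrite exprS DM IH mulrnAr mulrA -exprS [RHS]mulrS [X in X + _]mulrC.
by case: m {IH} => [|m].
Qed.

Section CharacteristicP.
Variables (p n : nat).
Hypothesis charK : p \in [pchar K].

Lemma iter_skew v :
  iter p skew v = iter p shift v + (fun k => iter p D (v k)).
Proof.
pose T i j : V := iter i shift (fun k => iter j D (v k)).
apply: (@iter_pascal_prime _ _ T) => [i j||u].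
- apply/funext => k; rewrite addE [LHS]/(shift (T i j) k + D (T i j k)).
  by congr (_ + _); rewrite /T !iter_shift; case: ifP; rewrite ?linear0.
- exact: pcharf_prime charK.
- exact: mulrn_pchar charK.
Qed.

(** In characteristic [p], the [p]-th power of a derivation is a derivation. *)
Lemma iter_derivationM a b :
  iter p D (a * b) = iter p D a * b + a * iter p D b.
Proof.
apply: (@iter_pascal_prime _ D (fun i j => iter i D a * iter j D b)) => [i j||u].
- by rewrite /= DM.
- exact: pcharf_prime charK.
- exact: mulrn_pchar charK.
Qed.

Hypothesis p_dvd_n : (p %| n)%N.
Hypothesis Dp0 : forall a, iter p D a = 0.
Hypothesis x_nil : x p.-1 = 0.

Local Notation z := (x 0 ^+ n - 1).

Lemma derivation_x0n1 : D z = 0.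
Proof.
rewrite linearB /= derivation1 subr0 derivation_exp.
by case/dvdnP: p_dvd_n => q ->; rewrite mulrnA (mulrn_pchar _ charK).
Qed.

(** The submodule generated by [h^p] and [x_0^n - 1]: multiples of [h^p] are
    the sequences that vanish below [p]. *)
Definition negligible (v : V) : Prop :=
  forall k, (k < p)%N -> exists b, v k = z * b.

Lemma negligible_act y v : negligible v -> negligible (act y v).
Proof.
have negl_sub : lin_subspace negligible.
  split=> [k _|u w nu nw k kp|a u nu k kp].
  - by exists 0; rewrite mulr0.
  - by have [b ub] := nu k kp; have [c wc] := nw k kp; exists (b + c);
      rewrite addE ub wc mulrDr.
  - by have [b ub] := nu k kp; exists (a *: b); rewrite scaleE ub -scalerAr.
have [_ nD nZ] := negl_sub.
move=> nv; apply: lin_subspace_sum => // w _; apply: nZ.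
elim: (monalg.fmonom_val w) v nv => [//|b {}w IH] v nv.
rewrite [word_act _ _ _]/(word_act gen_op w (gen_op b v)); apply: IH.
case: b => [|k kp]; last first.
  have [b vb] := nv k kp; exists (x 0 * b).
  by rewrite [LHS]/(x 0 * v k) vb mulrCA.
apply: (nD _ (fun k => D (v k))) => [[_|k /ltnW kp]|k kp].
- by exists 0; rewrite mulr0.
- exact: nv.
- by have [b ->] := nv k kp; exists (D b); rewrite DM derivation_x0n1 mul0r add0r.
Qed.

(** The annihilator of the quotient of the module by [negligible]. *)
Definition annihilator : set (free_alg K) := [set y | forall v, negligible (act y v)].

Lemma annihilator_ideal : two_sided_ideal annihilator.
Proof.
split=> [v k _|y t Jy Jt v k kp|a y Jy v|a y Jy v].
- by exists 0; rewrite ract0l mulr0.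
- have [b yb] := Jy v k kp; have [c tc] := Jt v k kp; exists (b + c).
  by rewrite ractDl addE yb tc mulrDr.
- by rewrite ractM; apply: Jy.
- by rewrite ractM; apply: negligible_act; apply: Jy.
Qed.

Lemma annihilator_lyndon (w : word) : lyndon w -> (2 <= count_mem gl w)%N ->
  annihilator (lyndon_bracket K w).
Proof.
move=> lw w2 v k _; have [_ _ w0] := act_bracket_rec lw (leqnn _).
by exists 0; rewrite [act _ _](w0 w2) mulr0.
Qed.

Lemma act_exp_gen b m v : act (free_gen K b ^+ m) v = iter m (gen_op b) v.
Proof.
elim: m v => [|m IH] v; first exact: ract1.
by rewrite exprSr ractM IH ract_gen.
Qed.

Lemma iter_mulop c m v : iter m (mulop c) v = mulop (c ^+ m) v.
Proof.
elim: m => [|m IH]; apply/funext => k; first by rewrite /mulop mul1r.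
by rewrite iterS IH /mulop mulrA exprS.
Qed.

Lemma annihilator_gn1 : annihilator (free_gen K gl ^+ n - 1).
Proof.
move=> v k _; exists (v k); rewrite ractBl ract1 act_exp_gen.
by rewrite addE oppE [iter _ _ _]iter_mulop mulrBl mul1r.
Qed.

Lemma annihilator_omega : annihilator (lyndon_bracket K (omega p.-1)).
Proof.
by move=> v k _; exists 0; rewrite act_bracket_omega x_nil /mulop mul0r mulr0.
Qed.

Lemma annihilator_hp : annihilator (free_gen K hl ^+ p).
Proof.
move=> v k kp; exists 0; rewrite mulr0 act_exp_gen.
rewrite [iter _ _ _]iter_skew addE iter_shift kp add0r; exact: Dp0.
Qed.

(** The ideal [annihilator] contains the first family of relations, and its image
    in each of the next quotients contains the next relation. *)
Lemma Tbarnp_kernel y : Tbarnp_proj n p y = 0 -> annihilator y.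
Proof.
have step (A : pzAlgType K) (S I : set A) : two_sided_ideal I -> S `<=` I ->
    two_sided_ideal (quot_proj S @` I) /\
    forall a, (quot_proj S @` I) (quot_proj S a) -> I a.
  move=> idI SI; split; first exact: two_sided_ideal_image.
  by move=> a [b Ib ba]; apply: quot_proj_kernel idI SI Ib _ _; rewrite ba.
have [|id1 k1] := step _ [set y | exists a : word,
    [/\ lyndon a, (2 <= count_mem gl a)%N & y = lyndon_bracket K a]] _
    annihilator_ideal.
  by move=> _ [w [lw w2 ->]]; apply: annihilator_lyndon.
have [|id2 k2] := step _ [set Tbar_proj (free_gen K gl) ^+ n - 1] _ id1.
  move=> _ ->; exists (free_gen K gl ^+ n - 1); first exact: annihilator_gn1.
  by rewrite rmorphB rmorphXn rmorph1.
have [|id3 k3] := step _ [set Tbarn_proj n (lyndon_bracket K (omega p.-1))] _ id2.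
  move=> _ ->; exists (Tbar_proj (lyndon_bracket K (omega p.-1))) => //.
  by exists (lyndon_bracket K (omega p.-1)) => //; apply: annihilator_omega.
have [|id4 k4] := step _ [set Tbarn'_proj n p (free_gen K hl) ^+ p] _ id3.
  move=> _ ->; exists (Tbarn_proj n (free_gen K hl ^+ p)).
    exists (Tbar_proj (free_gen K hl ^+ p)) => //.
    by exists (free_gen K hl ^+ p) => //; apply: annihilator_hp.
  by rewrite /Tbarn'_proj /Tbarn_proj /Tbar_proj !rmorphXn.
move=> y0; apply/k1/k2/k3/k4; rewrite -/(Tbarnp_proj n p y) y0.
by case: id4.
Qed.

End CharacteristicP.

(** The element [1 = h^0] of the module. *)
Definition vacuum : V := fun k => (k == 0)%:R.

Lemma iter_skew_vacuum a : iter a skew vacuum = fun k => (k == a)%:R.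
Proof.
have D01 (b : bool) : D b%:R = 0 by case: b; rewrite ?derivation1 ?linear0.
elim: a => [//|a IH]; rewrite iterS IH; apply/funext => k.
by rewrite /skew D01 addr0; case: k.
Qed.

Lemma act_prod (I : Type) (r : seq I) (F : I -> free_alg K) (c : I -> P) v :
  (forall i u, act (F i) u = mulop (c i) u) ->
  act (\prod_(i <- r) F i) v = mulop (\prod_(i <- r) c i) v.
Proof.
move=> Fc; elim: r v => [|i r IH] v; apply/funext => k.
  by rewrite !big_nil ract1 /mulop mul1r.
by rewrite !big_cons ractM IH Fc /mulop mulrA [X in X * v k]mulrC.
Qed.

Lemma act_exp y c m v : (forall u, act y u = mulop c u) ->
  act (y ^+ m) v = mulop (c ^+ m) v.
Proof.
move=> yc; rewrite -[m]subn0 -!prodr_const_nat.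
exact: (@act_prod _ _ (fun=> y) (fun=> c)).
Qed.

(** The power of [h] acts first, on a constant, which [D] kills; the factors that
    follow are multiplications. *)
Lemma act_pbw_monomial n p (i : 'I_p * {ffun 'I_(p - 2) -> nat} * 'I_n) k :
  act (pbw_monomial (free_gen K hl) (free_gen K gl)
        (fun s => lyndon_bracket K (omega s)) i) vacuum k =
  (x 0 ^+ i.2 * \prod_(j < p - 2) x j.+1 ^+ i.1.2 j) * (k == i.1.1)%:R.
Proof.
case: i => -[a e] c; rewrite !ractM act_exp_gen act_exp_gen.
rewrite [iter a _ _]iter_skew_vacuum [iter c _ _]iter_mulop.
rewrite (@act_prod _ _ _ (fun j => x (rev_ord j).+1 ^+ e (rev_ord j))).
  by rewrite /mulop mulrA [in RHS](reindex_inj rev_ord_inj).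
by move=> j u; apply: act_exp; apply: act_bracket_omega.
Qed.

End Model.

(** * The polynomial ring and linear independence *)

Section PolynomialModel.
Variables (K : fieldType) (m : nat).

Local Notation P := (mpoly.mpoly m.+1 K).
Local Notation mon := (mpoly.multinom m.+1).

(** Variables of index above [m] are zero, so that the derivation below sends each
    [xvar s] to [xvar s.+1], the last variable included. *)
Definition xvar (s : nat) : P :=
  if (s <= m)%N then mpoly.mpolyX K (mpoly.mnm1 (inord s)) else 0.

Lemma xvarE (i : 'I_m.+1) : xvar i = mpoly.mpolyX K (mpoly.mnm1 i).
Proof. by rewrite /xvar -ltnS ltn_ord inord_val. Qed.

Definition shift_derivation (f : P) : P :=
  \sum_(i < m.+1) xvar i.+1 * mpoly.mderiv i f.

Lemma shift_derivation_linear : linear shift_derivation.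
Proof.
move=> a f g; rewrite scaler_sumr -big_split; apply: eq_bigr => i _ /=.
by rewrite linearP mulrDr -scalerAr.
Qed.

HB.instance Definition _ := GRing.isLinear.Build K P P *:%R shift_derivation
  shift_derivation_linear.

Lemma shift_derivationM f g : shift_derivation (f * g) =
  shift_derivation f * g + f * shift_derivation g.
Proof.
rewrite mulr_suml mulr_sumr -big_split; apply: eq_bigr => i _ /=.
by rewrite mpoly.mderivM mulrDr !mulrA [f * _]mulrC.
Qed.

Lemma shift_derivation_xvar s : shift_derivation (xvar s) = xvar s.+1.
Proof.
rewrite {1}/xvar; case: leqP => [sm|ms]; last first.
  by rewrite linear0 /xvar ltnNge ltnW.
rewrite /shift_derivation (bigD1 (inord s)) //= big1 ?addr0 => [|i /negPf is_].
  rewrite inordK // mpoly.mderivX mpoly.mnm1E eqxx scale1r.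
  rewrite (_ : mpoly.mnm_sub _ _ = mpoly.mnm0) ?mpoly.mpolyX0 ?mulr1 //.
  by apply/mpoly.mnmP => j; rewrite mpoly.mnmBE subnn mpoly.mnm0E.
by rewrite mpoly.mderivX mpoly.mnm1E eq_sym is_ scale0r mulr0.
Qed.

(** [D^p] is a derivation, and it sends [x_s] to [x_(s+p)], which is zero. *)
Lemma iter_shift_derivation p : p \in [pchar K] -> (m < p)%N ->
  forall f, iter p shift_derivation f = 0.
Proof.
move=> charK mp f; pose D := iter p shift_derivation.
have Dlin : linear D.
  by move=> a; rewrite /D; elim: (p) => [|q IH] u v //; rewrite !iterS IH linearP.
have it0 q : iter q shift_derivation 0 = 0.
  by elim: q => // q IH; rewrite iterS IH linear0.
have D0 : D 0 = 0 := it0 p.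
have DZ a u : D u = 0 -> D (a *: u) = 0.
  by move=> Du; have := Dlin a u 0; rewrite addr0 Du D0 scaler0 addr0.
have DD u v : D u = 0 -> D v = 0 -> D (u + v) = 0.
  by move=> Du Dv; have := Dlin 1 u v; rewrite !scale1r Du Dv addr0.
have DM u v : D u = 0 -> D v = 0 -> D (u * v) = 0.
  by rewrite /D (iter_derivationM shift_derivationM charK) => -> ->; rewrite mul0r mulr0 addr0.
have D1 : D 1 = 0.
  rewrite /D; case: (p) (prime_gt0 (pcharf_prime charK)) => // q _.
  by rewrite iterSr (derivation1 shift_derivationM).
rewrite -/(D f) (mpoly.mpolyE f); apply: (big_ind (fun u => D u = 0)) => // mu _; apply: DZ.
rewrite mpoly.mpolyXE_id; apply: (big_ind (fun u => D u = 0)) => // i _.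
suff Dvar : D (mpoly.mpolyX K (mpoly.mnm1 i)) = 0.
  by elim: (mpoly.fun_of_multinom mu i) => [|k IH]; rewrite ?expr0 ?exprS //; apply: DM.
rewrite -xvarE.
have it q s : iter q shift_derivation (xvar s) = xvar (s + q).
  by elim: q => [|q IH]; rewrite ?addn0 // iterS IH shift_derivation_xvar addnS.
by rewrite /D it /xvar leqNgt (leq_trans mp) ?leq_addl.
Qed.

Definition pbw_exponent (c : nat) (e : {ffun 'I_m -> nat}) : mon :=
  mpoly.Multinom [tuple if unlift ord0 i is Some j then e j else c | i < m.+1].

Lemma pbw_exponent0 c e : mpoly.fun_of_multinom (pbw_exponent c e) ord0 = c.
Proof. by rewrite /pbw_exponent mpoly.mnmE unlift_none. Qed.

Lemma pbw_exponentS c e j :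
  mpoly.fun_of_multinom (pbw_exponent c e) (lift ord0 j) = e j.
Proof. by rewrite /pbw_exponent mpoly.mnmE liftK. Qed.

Lemma pbw_exponent_inj c e c' e' : pbw_exponent c e = pbw_exponent c' e' -> c = c' /\ e = e'.
Proof.
move=> E; split; first by rewrite -(pbw_exponent0 c e) E pbw_exponent0.
by apply/ffunP => j; rewrite -(pbw_exponentS c e) E pbw_exponentS.
Qed.

Lemma xvar_monomial c (e : {ffun 'I_m -> nat}) :
  xvar 0 ^+ c * \prod_(j < m) xvar j.+1 ^+ e j = mpoly.mpolyX K (pbw_exponent c e).
Proof.
rewrite mpoly.mpolyXE_id big_ord_recl pbw_exponent0 -xvarE; congr (_ * _).
by apply: eq_bigr => j _; rewrite pbw_exponentS -xvarE.
Qed.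

(** Leading monomials are multiplicative, and that of [x_0^n - 1] is [x_0^n]. *)
Lemma multiple_of_xvar0n1 n (f b : P) : (0 < n)%N -> f = (xvar 0 ^+ n - 1) * b ->
  (forall mu, mpoly.mcoeff mu f != 0 -> (mpoly.fun_of_multinom mu ord0 < n)%N) ->
  f = 0.
Proof.
move=> n0 fE fn; apply/eqP/negPn/negP => f0.
have zE : mpoly.mlead (xvar 0 ^+ n - 1) = mpoly.mnm_muln (mpoly.mnm1 ord0) n.
  rewrite (xvarE ord0) mpoly.mpolyXn mpoly.mleadDl mpoly.mleadXm //.
  rewrite mpoly.mleadN mpoly.mlead1 lt_neqAle mpoly.le0m andbT.
  apply/eqP => /(congr1 (fun mu => mpoly.fun_of_multinom mu ord0)).
  rewrite mpoly.mnm0E mpoly.mulmnE mpoly.mnm1E eqxx mul1n => nE.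
  by rewrite -nE in n0.
have z0 : xvar 0 ^+ n - 1 != 0 by apply: contraNneq f0 => z0; rewrite fE z0 mul0r.
have b0 : b != 0 by apply: contraNneq f0 => b0; rewrite fE b0 mulr0.
have := fn _ (etrans (esym (mpoly.mcoeff_msupp _ _)) (mpoly.mlead_supp f0)).
rewrite {1}fE mpoly.mleadM // zE mpoly.mnmDE mpoly.mulmnE mpoly.mnm1E eqxx mul1n.
by rewrite ltnNge leq_addr.
Qed.

End PolynomialModel.

Lemma rmorph_pbw_monomial (A B : pzRingType) (f : {rmorphism A -> B}) h g E n p
    (i : 'I_p * {ffun 'I_(p - 2) -> nat} * 'I_n) :
  f (pbw_monomial h g E i) = pbw_monomial (f h) (f g) (f \o E) i.
Proof.
case: i => -[a e] c; rewrite /pbw_monomial !rmorphM !rmorphXn rmorph_prod.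
by congr (_ * _ * _); apply: eq_bigr => j _; rewrite rmorphXn.
Qed.

Section Projection.
Variables (K : fieldType) (n p : nat).

HB.instance Definition _ := GRing.RMorphism.copy (@Tbarnp_proj K n p)
  (quot_proj _ \o (quot_proj _ \o (quot_proj _ \o quot_proj _))).
HB.instance Definition _ := GRing.Linear.copy (@Tbarnp_proj K n p)
  (quot_proj _ \o (quot_proj _ \o (quot_proj _ \o quot_proj _))).

Lemma Tbarnp_proj_surj (y : Tbarnp K n p) : exists x, Tbarnp_proj n p x = y.
Proof.
have [y1 <-] := quot_proj_surj y; have [y2 <-] := quot_proj_surj y1.
by have [y3 <-] := quot_proj_surj y2; have [x <-] := quot_proj_surj y3; exists x.
Qed.

Local Notation g := (free_gen K gl).
Local Notation h := (free_gen K hl).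
Local Notation E s := (lyndon_bracket K (omega s)).

Lemma Tbarnp_proj_pbw (i : 'I_p * {ffun 'I_(p - 2) -> nat} * 'I_n) :
  Tbarnp_proj n p (pbw_monomial h g (fun s => E s) i) =
  pbw_monomial (Tbarnp_proj n p h) (Tbarnp_proj n p g)
    (fun s => Tbarnp_proj n p (E s)) i.
Proof. exact: (rmorph_pbw_monomial (@Tbarnp_proj K n p)). Qed.

(** A vanishing combination, lifted to the free algebra, sends [vacuum] into the
    submodule [negligible].  At the coordinate given by the power of [h] in the
    monomial of index [i0], this is a multiple of [x_0^n - 1] of degree less than
    [n] in [x_0], hence zero, and [c i0] is one of its coefficients. *)
Lemma pbw_lin_indep : p \in [pchar K] -> (0 < n)%N -> (p %| n)%N ->
  lin_indep (pbw_monomial (Tbarnp_proj n p h) (Tbarnp_proj n p g)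
    (fun s => Tbarnp_proj n p (E s)) (n := n) (p := p)).
Proof.
move=> charK n0 p_dvd_n s c us sum0 i0 i0s.
have p2 : (2 <= p)%N by apply: prime_gt1; apply: pcharf_prime charK.
set m := (p - 2)%N; pose D := @shift_derivation K m.
have nil : xvar K m p.-1 = 0 by rewrite /xvar leqNgt /m; case: ifP => //; lia.
pose y := \sum_(i <- s) c i *: pbw_monomial h g (fun s => E s) i.
have : Tbarnp_proj n p y = 0.
  rewrite -[RHS]sum0 linear_sum; apply: eq_bigr => i _.
  rewrite linearZ_LR; congr (_ *: _); exact: Tbarnp_proj_pbw.
move/(Tbarnp_kernel (@shift_derivationM K m) (@shift_derivation_xvar K m) charK
  p_dvd_n (iter_shift_derivation charK _) nil).
have mp : (m < p)%N by rewrite /m; lia.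
move=> /(_ mp (vacuum _) i0.1.1 (ltn_ord _)) [b].
pose mon (i : 'I_p * {ffun 'I_m -> nat} * 'I_n) := pbw_exponent i.2 i.1.2.
pose f := \sum_(i <- s) c i *: (mpoly.mpolyX K (mon i) *+ (i0.1.1 == i.1.1)).
rewrite (_ : ract _ _ _ _ = f); last first.
  rewrite /y (big_morph (fun t => ract (gen_op D (xvar K m)) t (vacuum _) i0.1.1)
    (id1 := 0) (op1 := +%R)); last by rewrite ract0l.
    apply: eq_bigr => i _; rewrite ractZl [LHS]/(_ *: _); congr (_ *: _).
    rewrite (act_pbw_monomial (@shift_derivationM K m) (@shift_derivation_xvar K m)).
    by rewrite xvar_monomial mulr_natr.
  by move=> t u; rewrite ractDl.
have coefE mu : mpoly.mcoeff mu f =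
    \sum_(i <- s) c i * ((mon i == mu)%:R *+ (i0.1.1 == i.1.1)).
  rewrite linear_sum /=; apply: eq_bigr => i _.
  by rewrite mpoly.mcoeffZ mpoly.mcoeffMn mpoly.mcoeffX.
move/(multiple_of_xvar0n1 n0) => f0.
have {f0} : f = 0.
  apply: f0 => mu; rewrite coefE; apply: contraNT; rewrite -leqNgt => n_mu.
  rewrite big1 // => i _; case: eqP => [mon_i|]; last by rewrite mul0rn mulr0.
  by move: n_mu; rewrite -mon_i pbw_exponent0 leqNgt ltn_ord.
move/(congr1 (mpoly.mcoeff (mon i0))); rewrite coefE mpoly.mcoeff0.
rewrite (bigD1_seq i0) //= !eqxx mulr1 big1 ?addr0 // => i ii0.
case: eqP => [/pbw_exponent_inj[/val_inj e1 e2]|]; last by rewrite mul0rn mulr0.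
case: eqP => [e3|]; last by rewrite mulr0.
case/eqP: ii0; case: (i) e1 e2 e3 => -[a e] d /= -> -> <-.
by case: (i0) => -[].
Qed.
End Projection.

(** * Spanning and Gelfand-Kirillov dimension *)

Section Spanning.
Variables (K : fieldType) (A : pzAlgType K) (g h : A) (E : nat -> A) (n p : nat).
Hypothesis p_gt0 : (0 < p)%N.
Hypothesis n_gt0 : (0 < n)%N.
Hypothesis E0 : E 0%N = g.
Hypothesis gn1 : g ^+ n = 1.
Hypothesis hp0 : h ^+ p = 0.
Hypothesis Eh : forall s, E s * h = h * E s + E s.+1.
Hypothesis E_nil : forall s, (p - 2 < s)%N -> E s = 0.
Hypothesis EC : forall s t, E s * E t = E t * E s.
Hypothesis generated : forall x : A,
  lin_span (range (fun w : seq bool => \prod_(b <- w) (if b then h else g))) x.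

Local Notation m := (p - 2)%N.
Local Notation pbw := (pbw_monomial h g E (n := n) (p := p)).

Definition Eword (w : seq nat) : A := \prod_(s <- w) E s.

(** Powers of [h] do not count in the degree, so that right multiplication by [h]
    preserves the filtration. *)
Definition filt (N : nat) : set A :=
  lin_span [set x | exists a w, (size w <= N)%N /\ x = h ^+ a * Eword w].

Lemma filt_mem N a w : (size w <= N)%N -> filt N (h ^+ a * Eword w).
Proof. by move=> wN; apply: subset_lin_span; exists a, w. Qed.

Lemma filt_subspace N : lin_subspace (filt N).
Proof. exact: lin_span_subspace. Qed.

Lemma filtS N M : (N <= M)%N -> filt N `<=` filt M.
Proof.
move=> NM; apply: lin_spanS => _ [a [w [wN ->]]]; exists a, w; split=> //.
exact: leq_trans NM.
Qed.

(** Moving [h] across a letter [E_s] either leaves the letter or turns it into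
    [E_(s+1)], so that the remainder has the same length. *)
Lemma Eword_h w : exists2 d,
  lin_span [set x | exists2 w', size w' = size w & x = Eword w'] d &
  Eword w * h = h * Eword w + d.
Proof.
elim: w => [|s w [d dw IH]].
  exists 0; first by have [] := lin_span_subspace
    [set x | exists2 w', size w' = size ([::] : seq nat) & x = Eword w'].
  by rewrite /Eword big_nil mul1r mulr1 addr0.
set B := [set x | _]; have [_ BD _] := lin_span_subspace B.
exists (E s.+1 * Eword w + E s * d).
  apply: BD; first by apply: subset_lin_span; exists (s.+1 :: w); rewrite // /Eword big_cons.
  apply: (lin_spanM (B := [set E s])) dw; first exact: lin_span_subspace.
    move=> _ _ -> [w' sw' ->]; apply: subset_lin_span.
    by exists (s :: w'); rewrite /= ?sw' // /Eword big_cons.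
  exact: subset_lin_span.
by rewrite /Eword big_cons -/(Eword w) -mulrA IH mulrDr !mulrA Eh mulrDl -!addrA.
Qed.

Lemma filt_h N x : filt N x -> filt N (x * h).
Proof.
have [_ FD _] := filt_subspace N.
move=> Fx; apply: (lin_spanM (C := [set h]) _ _ Fx); last exact: subset_lin_span.
  exact: filt_subspace.
move=> _ _ [a [w [wN ->]]] ->; have [d dw wh] := Eword_h w.
rewrite -mulrA wh mulrDr mulrA -exprSr; apply: FD; first exact: filt_mem.
apply: (lin_spanM (B := [set h ^+ a])) dw; first exact: filt_subspace.
  by move=> _ _ -> [w' sw' ->]; apply: filt_mem; rewrite sw'.
exact: subset_lin_span.
Qed.

Lemma filt_Eword N x w : filt N x -> filt (N + size w) (x * Eword w).
Proof.
move=> Fx; apply: (lin_spanM (C := [set Eword w]) _ _ Fx); last exact: subset_lin_span.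
  exact: filt_subspace.
move=> _ _ [a [w' [wN ->]]] ->; rewrite -mulrA /Eword -big_cat.
by apply: filt_mem; rewrite size_cat leq_add2r.
Qed.

Lemma filtM N M x y : filt N x -> filt M y -> filt (N + M) (x * y).
Proof.
move=> Fx Fy; have hx a : filt N (x * h ^+ a).
  by elim: a => [|a IH]; rewrite ?mulr1 // exprSr mulrA; apply: filt_h.
apply: (lin_spanM (B := [set x]) _ _ _ Fy); [exact: filt_subspace | | exact: subset_lin_span].
move=> _ _ -> [a [w [wM ->]]]; rewrite mulrA.
by apply: filtS (filt_Eword w (hx a)); rewrite leq_add2l.
Qed.

Lemma filt1 N : filt N 1.
Proof. by have := @filt_mem N 0 [::] isT; rewrite /Eword big_nil mulr1. Qed.

Lemma filt_prod d (s : seq A) : (forall x, x \in s -> filt d x) ->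
  filt (d * size s) (\prod_(x <- s) x).
Proof.
elim: s => [|x s IH] Fs; first by rewrite big_nil; apply: filt1.
rewrite big_cons /= mulnS; apply: filtM; first by apply: Fs; rewrite mem_head.
by apply: IH => y ys; apply: Fs; rewrite in_cons ys orbT.
Qed.

Lemma filt_exhaustive x : exists N, filt N x.
Proof.
suff sub : lin_subspace [set x | exists N, filt N x].
  apply: (lin_span_sub sub _ (generated x)) => _ [w _ <-]; exists (size w).
  elim/last_ind: w => [|w b IH]; first by rewrite big_nil; apply: filt1.
  rewrite -cats1 big_cat big_seq1 size_cat /=; case: b.
    by apply: filt_h; apply: filtS IH; apply: leq_addr.
  by have := filt_Eword [:: 0%N] IH; rewrite /Eword big_seq1 E0.
split=> [|y z [N Fy] [M Fz]|a y [N Fy]].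
- by exists 0%N; have [] := filt_subspace 0.
- exists (maxn N M); have [_ FD _] := filt_subspace (maxn N M).
  by apply: FD; [apply: filtS Fy | apply: filtS Fz]; rewrite ?leq_maxl ?leq_maxr.
- by exists N; have [_ _ FZ] := filt_subspace N; apply: FZ.
Qed.

Definition Emonomial (e : 'I_m -> nat) : A :=
  \prod_(j < m) E (rev_ord j).+1 ^+ e (rev_ord j).

Lemma EmonomialD e1 e2 :
  Emonomial (fun j => e1 j + e2 j)%N = Emonomial e1 * Emonomial e2.
Proof.
rewrite -prodrM_comm => [|i j _ _].
  by apply: eq_bigr => j _; rewrite exprD.
by apply: commrX; apply/commr_sym/commrX/EC.
Qed.

Lemma Emonomial0 : Emonomial (fun=> 0%N) = 1.
Proof. by apply: big1. Qed.

Lemma Emonomial_delta j : Emonomial (fun i => i == j) = E j.+1.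
Proof.
rewrite /Emonomial (big_only1 (rev_ord j)) // => [|i ij _].
  by rewrite rev_ordK eqxx expr1.
by rewrite -(inj_eq rev_ord_inj) rev_ordK (negPf ij).
Qed.

Lemma Emonomial_sum N (e : nat -> 'I_m -> nat) :
  Emonomial (fun j => \sum_(t < N) e t j)%N = \prod_(t < N) Emonomial (e t).
Proof.
elim: N => [|N IH].
  by rewrite big_ord0 -Emonomial0; congr Emonomial; apply/funext => j; rewrite big_ord0.
rewrite big_ord_recr /= -IH -EmonomialD; congr Emonomial; apply/funext => j.
by rewrite big_ord_recr.
Qed.

(** The exponent [c] of [g] is left unbounded here: it is reduced modulo [n]
    later, while the bound on the other exponents is what controls the growth. *)
Lemma Eword_sorted w : Eword w = 0 \/
  exists e c, (forall j, e j <= size w)%N /\ Eword w = Emonomial e * g ^+ c.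
Proof.
elim: w => [|s w].
  right; exists (fun=> 0%N), 0%N; split=> //.
  by rewrite /Eword big_nil Emonomial0 mulr1.
rewrite /Eword big_cons -/(Eword w) => -[->|[e [c [ew ->]]]].
  by left; rewrite mulr0.
have [/E_nil ->|sm] := ltnP m s; first by left; rewrite mul0r.
case: s sm => [_|s sm]; right.
  exists e, c.+1; split=> [j|]; first exact: leqW.
  rewrite E0 mulrA [g * _](_ : _ = Emonomial e * g) ?exprS ?mulrA //.
  by apply: commr_prod => j _; apply: commrX; rewrite -E0; apply: EC.
exists (fun j => (j == Ordinal sm) + e j)%N, c; split=> [j|].
  by apply: (@leq_add _ _ 1) => //; case: eqP.
by rewrite EmonomialD Emonomial_delta mulrA.
Qed.

Definition bounded_pbw N (i : 'I_p * {ffun 'I_m -> 'I_N.+1} * 'I_n) : A :=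
  pbw (i.1.1, [ffun j => i.1.2 j : nat], i.2).

Lemma filt_span_pbw N : filt N `<=` lin_span (range (@bounded_pbw N)).
Proof.
have [F0 _ _] := lin_span_subspace (range (@bounded_pbw N)).
apply: lin_span_sub; first exact: lin_span_subspace.
move=> _ [a [w [wN ->]]]; have [->|[e [c [ew ->]]]] := Eword_sorted w.
  by rewrite mulr0; apply: F0.
have [pa|ap] := leqP p a.
  by rewrite -(subnK pa) exprD hp0 mulr0 mul0r; apply: F0.
apply: subset_lin_span.
exists (Ordinal ap, [ffun j => inord (e j)], Ordinal (ltn_pmod c n_gt0)) => //.
rewrite /bounded_pbw /= expr_mod // -mulrA; congr (_ * (_ * _)).
by apply: eq_bigr => j _; rewrite !ffunE inordK // ltnS (leq_trans (ew _) wN).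
Qed.

Lemma pbw_span : lin_span (range pbw) = setT.
Proof.
apply/seteqP; split=> // x _; have [N /filt_span_pbw] := filt_exhaustive x.
apply: lin_spanS => _ [i _ <-].
by exists (i.1.1, [ffun j => i.1.2 j : nat], i.2).
Qed.

Variable R : realType.

(** The finitely many generators of [V] lie in a common [filt d], hence the
    products of at most [k] elements of [V] lie in [filt (d * k)]. *)
Lemma GKdim_pbw_le : (GKdim A R <= m%:R%:E)%E.
Proof.
apply: GKdim_le => V [r [b VE]].
have /choice[N FN] : forall i, exists N, filt N (b i).
  by move=> i; apply: filt_exhaustive.
pose d := (\max_i N i)%N.
have Vd : V `<=` filt d.
  rewrite VE; apply: lin_span_sub; first exact: filt_subspace.
  by move=> _ [i _ <-]; apply: filtS (FN i); apply: leq_bigmax.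
exists (p * n)%N, d; split=> [|k]; first by rewrite muln_gt0 p_gt0.
apply: le_trans (lin_dim_le R (v := @bounded_pbw (d * k)) _) _.
  apply: subset_trans (@filt_span_pbw (d * k)).
  apply: lin_span_sub; first exact: filt_subspace.
  move=> _ [s [sk sV] <-].
  have Fs : filt (d * size s) (\prod_(x <- s) x).
    by apply: filt_prod => x xs; apply/Vd/sV.
  by apply: filtS Fs; rewrite leq_mul2l sk orbT.
by rewrite lee_fin ler_nat !card_prod card_ffun !card_ord mulnAC.
Qed.

(** The subspace [V] is spanned by the square-free monomials in the [E_j].  A
    monomial whose exponents [e_j] are less than [k] is the product over [t < k]
    of the square-free monomials of the indices [j] with [t < e_j]; its [k]
    factors are in [V]. *)
Lemma GKdim_pbw_ge : lin_indep pbw -> (m%:R%:E <= GKdim A R)%E.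
Proof.
move=> pbw_free.
pose b (S : {ffun 'I_m -> bool}) := Emonomial (fun j => S j).
pose V := lin_span (range b).
apply: (@GKdim_ge _ _ _ _ V).
  exists #|{ffun 'I_m -> bool}|, (b \o enum_val); congr lin_span.
  apply/seteqP; split=> [_ [S _ <-]|_ [i _ <-]]; last by exists (enum_val i).
  by exists (enum_rank S) => //=; rewrite enum_rankK.
move=> k.
pose f (e : {ffun 'I_m -> 'I_k}) : 'I_p * {ffun 'I_m -> nat} * 'I_n :=
  (Ordinal p_gt0, [ffun j => e j : nat], Ordinal n_gt0).
have f_inj : injective f.
  move=> e e' [/ffunP ee']; apply/ffunP => j; apply: val_inj.
  by have := ee' j; rewrite !ffunE.
have <- : #|{ffun 'I_m -> 'I_k}| = (k ^ m)%N by rewrite card_ffun !card_ord.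
apply: (@lin_dim_ge _ _ _ _ (pbw \o f)); first exact: lin_indep_comp.
move=> e; apply: subset_lin_span.
pose S (t : nat) : {ffun 'I_m -> bool} := [ffun j => (t < e j)%N].
exists [seq b (S t) | t <- iota 0 k].
  split; first by rewrite size_map size_iota.
  by move=> _ /mapP[t _ ->]; apply: subset_lin_span; exists (S t).
rewrite big_map -[X in iota 0 X]subn0 -/(index_iota 0 k) big_mkord.
rewrite -(Emonomial_sum k (fun t j => S t j)).
rewrite /= /f mul1r mulr1; apply: eq_bigr => j _; rewrite ffunE; congr (_ ^+ _).
under eq_bigr => t _ do rewrite ffunE.
have sum_lt l q : (\sum_(t < l) (t < q) = minn l q)%N.
  elim: l => [|l IH]; first by rewrite big_ord0 min0n.
  by rewrite big_ord_recr /= IH; lia.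
by rewrite sum_lt; apply/minn_idPr/ltnW.
Qed.
End Spanning.

(** * The relations and the theorem *)

Lemma rmorph_commutator (A B : pzRingType) (f : {rmorphism A -> B}) x y :
  f (commutator x y) = commutator (f x) (f y).
Proof. by rewrite /commutator rmorphB !rmorphM. Qed.

Lemma comm_of_lt (A : pzRingType) (F : nat -> A) :
  (forall s t, (s < t)%N -> commutator (F s) (F t) = 0) ->
  forall s t, F s * F t = F t * F s.
Proof.
move=> Flt s t; case: (ltngtP s t) => [/Flt/eqP|/Flt/eqP|-> //].
  by rewrite subr_eq0 => /eqP.
by rewrite subr_eq0 => /eqP.
Qed.

Section Relations.
Variables (K : fieldType) (n p : nat).
Local Notation A := (Tbarnp K n p).
Local Notation pi := (@Tbarnp_proj K n p).
Local Notation E s := (lyndon_bracket K (omega s)).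
Local Notation g := (free_gen K gl).
Local Notation h := (free_gen K hl).

Lemma Tbarnp_commutator x y : pi (commutator x y) = commutator (pi x) (pi y).
Proof. exact: rmorph_commutator. Qed.

Lemma Tbarnp_proj_eq0 x : Tbar_proj x = 0 -> pi x = 0.
Proof.
by move=> x0; rewrite /Tbarnp_proj /Tbarn'_proj /Tbarn_proj x0 !rmorph0.
Qed.

(** For [s < t] the commutator is the bracket of the Lyndon word [g h^s g h^t],
    which has two letters [g]. *)
Lemma Tbarnp_omega_comm s t : pi (E s) * pi (E t) = pi (E t) * pi (E s).
Proof.
move: s t; apply: comm_of_lt => s t st; rewrite -Tbarnp_commutator.
rewrite -(lyndon_bracketE K (std_factorization_omega_cat s t)).
have /Tbarnp_proj_eq0 -> // : Tbar_proj (lyndon_bracket K (omega s ++ omega t)) = 0.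
apply: quot_proj_eq0; exists (omega s ++ omega t); split=> //.
  exact: lyndon_omega_cat.
by rewrite count_cat /= !add1n addSn addnS.
Qed.

Lemma Tbarnp_gn : pi g ^+ n = 1.
Proof.
have gn : Tbarn_proj n (g ^+ n - 1) = 0.
  by apply: quot_proj_eq0; rewrite /Tbar_proj rmorphB rmorphXn rmorph1.
have : pi (g ^+ n - 1) = 0 by rewrite /Tbarnp_proj /Tbarn'_proj gn !rmorph0.
by rewrite rmorphB rmorphXn rmorph1 => /eqP; rewrite subr_eq0 => /eqP.
Qed.

Lemma Tbarnp_hp : pi h ^+ p = 0.
Proof.
have : pi (h ^+ p) = 0.
  apply: quot_proj_eq0.
  by rewrite /Tbarn'_proj /Tbarn_proj /Tbar_proj !rmorphXn.
by rewrite rmorphXn.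
Qed.

Lemma Tbarnp_omega_h s : pi (E s) * pi h = pi h * pi (E s) + pi (E s.+1).
Proof.
rewrite lyndon_bracket_omegaS Tbarnp_commutator /commutator.
by rewrite [RHS]addrC subrK.
Qed.

(** Each [E_(s+1)] is the commutator of [E_s] and [h], so that all the [E_s]
    vanish from the first one that does. *)
Lemma Tbarnp_omega_nil s : (p.-1 <= s)%N -> pi (E s) = 0.
Proof.
move=> /subnKC <-; elim: (s - p.-1)%N => [|k IH].
  have E0 : Tbarn'_proj n p (E p.-1) = 0 by apply: quot_proj_eq0.
  by rewrite addn0 /Tbarnp_proj E0 rmorph0.
by rewrite addnS lyndon_bracket_omegaS Tbarnp_commutator IH /commutator mulr0 mul0r subrr.
Qed.

Lemma Tbarnp_generated (x : A) :
  lin_span (range (fun w : seq bool => \prod_(b <- w) (if b then pi h else pi g))) x.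
Proof.
have [y <-] := Tbarnp_proj_surj x.
have -> : (fun w => \prod_(b <- w) (if b then pi h else pi g)) = pi \o free_word K.
  by apply/funext => w; exact/esym/(rmorph_free_word pi).
have span_pi := @lin_span_linear K (free_alg K) A (pi : {linear free_alg K -> A}).
exact: (span_pi _ _ _ (free_alg_span y)).
Qed.
End Relations.

Theorem lemma3p10 (R : realType) (K : fieldType) (p n : nat)
    (charK : p \in [pchar K]) (n_ge2 : (2 <= n)%N) (p_dvd_n : (p %| n)%N)
    (Egh_neq0 : Tbarn_proj n (lyndon_bracket K (omega 1)) <> 0) :
  let A := Tbarnp K n p in
  let g : A := Tbarnp_proj n p (free_gen K gl) in
  let h : A := Tbarnp_proj n p (free_gen K hl) in
  let E (k : nat) : A := Tbarnp_proj n p (lyndon_bracket K (omega k)) in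
  [/\ GKdim A R = ((p - 2)%:R : R)%:E,
      is_basis (pbw_monomial h g E (n := n) (p := p)) &
      [/\ g ^+ n = 1,
          h ^+ p = 0,
          forall s t : nat, (s < t)%N -> (t <= p - 2)%N ->
            E s * h = h * E s + E s.+1,
          E (p - 2)%N * h = h * E (p - 2)%N &
          forall s t : nat, (s < t)%N -> (t <= p - 2)%N ->
            E s * E t = E t * E s]].
Proof.
move=> A g h E.
have p2 : (2 <= p)%N by apply: prime_gt1; apply: pcharf_prime charK.
have p0 : (0 < p)%N := ltnW p2.
have n0 : (0 < n)%N := ltnW n_ge2.
have E_nil s : (p - 2 < s)%N -> E s = 0 by move=> ps; apply: Tbarnp_omega_nil; lia.
have pbw_free : lin_indep (pbw_monomial h g E (n := n) (p := p)).
  exact: pbw_lin_indep charK n0 p_dvd_n.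
split.
- apply/eqP; rewrite eq_le; apply/andP; split.
    exact: (GKdim_pbw_le p0 n0 erefl (Tbarnp_gn _ _ _) (Tbarnp_hp _ _ _) (@Tbarnp_omega_h K n p)
      E_nil (@Tbarnp_omega_comm K n p) (@Tbarnp_generated K n p)).
  exact: (@GKdim_pbw_ge K A g h E n p p0 n0 (@Tbarnp_omega_comm K n p) R pbw_free).
- split=> //.
  exact: (pbw_span n0 erefl (Tbarnp_gn _ _ _) (Tbarnp_hp _ _ _) (@Tbarnp_omega_h K n p)
      E_nil (@Tbarnp_omega_comm K n p) (@Tbarnp_generated K n p)).
- split=> [| |s t _ _| |s t _ _].
  + exact: Tbarnp_gn.
  + exact: Tbarnp_hp.
  + exact: Tbarnp_omega_h.
  + by rewrite [LHS]Tbarnp_omega_h [X in _ + X]E_nil ?addr0.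
  + exact: Tbarnp_omega_comm.
Qed.
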